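(* Let $\operatorname{Re} a>0$. Then $$\gamma_0(a)=\frac{1}{2a}-\ln a-\frac{1}{\pi a}\sum_{k=0}^\infty\frac{(2k+1)!\,(-1)^k}{(2\pi a)^{2k+1}}\sum_{n=1}^\infty\frac{s(n,2k+1)(-1)^n}{n!\,n}.$$
   Context: The Hurwitz zeta function is $\zeta(s,a)=\sum_{n=0}^\infty (n+a)^{-s}$ for $\operatorname{Re} s>1$, continued analytically in $s$, with a simple pole at $s=1$. The Stieltjes constants $\gamma_n(a)$, $n\ge 0$, are defined by the Laurent expansion about $s=1$, $$\zeta(s,a)=\frac{1}{s-1}+\sum_{n=0}^\infty\frac{(-1)^n}{n!}\gamma_n(a)(s-1)^n,$$ and $\gamma_0(a)=-\psi(a)$ with $\psi=\Gamma'/\Gamma$ the digamma function. $s(n,k)$ denotes the (signed) Stirling numbers of the first kind, so that $\sum_{n=0}^\infty s(n,k)\frac{x^n}{n!}=\frac{1}{k!}\ln^k(1+x)$ for $|x|<1$, and $s(n,k)=0$ for $n<k$. The author remarks that this formula may be considered the expansion of $\gamma_0(a)$, or of the digamma function, about $|a|\to\infty$ with $\arg a<\pi$.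
   Formalization: The outer series over k diverges for every a (the inner sum is −ζ(2k+2)), so ''='' is read as an asymptotic expansion: for each N, γ₀(a) minus the right side cut after k=N is o(a^{-(2N+2)}) as |a|→∞, uniformly in Re a>0. *)

(* Defs.v *)
From Stdlib Require Import Reals Arith ZArith.
From Coquelicot Require Import Coquelicot.
Open Scope R_scope.

Definition Cexp (z : C) : C :=
  (exp (Re z) * cos (Im z), exp (Re z) * sin (Im z)).

(* Principal argument, with values in (-PI, PI]; meaningful for z <> 0. *)
Definition Carg (z : C) : R :=
  if Rle_dec 0 (Im z) then acos (Re z / Cmod z) else - acos (Re z / Cmod z).

Definition Cln (z : C) : C := (ln (Cmod z), Carg z).

Definition Cpower (z w : C) : C := Cexp (w * Cln z)%C.

(* [Z] is the Hurwitz zeta function s |-> zeta(s, a): the Dirichlet series for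
   Re s > 1, continued to a holomorphic function on C \ {1}. *)
Definition is_hurwitz_zeta (a : C) (Z : C -> C) : Prop :=
  (forall s : C, 1 < Re s ->
     is_series (V := C_NormedModule)
       (fun n : nat => Cpower (RtoC (INR n) + a)%C (- s)%C) (Z s)) /\
  (forall s : C, s <> RtoC 1 ->
     ex_derive (K := C_AbsRing) (V := C_NormedModule) Z s).

(* [g n] is the Stieltjes constant gamma_n(a), read off the Laurent expansion
   of zeta(s, a) about s = 1, required in a punctured neighbourhood of 1; this
   determines [g]. *)
Definition is_stieltjes (a : C) (g : nat -> C) : Prop :=
  exists Z : C -> C,
    is_hurwitz_zeta a Z /\
    locally' (T := C_UniformSpace) (RtoC 1) (fun s : C =>
      is_pseries (K := C_AbsRing) (V := C_NormedModule)
        (fun n : nat => (RtoC ((-1) ^ n / INR (fact n)) * g n)%C)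
        (s - RtoC 1)%C
        (Z s - RtoC 1 / (s - RtoC 1))%C).

(* Signed Stirling numbers of the first kind:
   x (x - 1) ... (x - n + 1) = sum_k s(n, k) x^k. *)
Fixpoint stirling1 (n k : nat) : Z :=
  match n, k with
  | O, O => 1
  | O, S _ => 0
  | S n', O => - Z.of_nat n' * stirling1 n' O
  | S n', S k' => stirling1 n' k' - Z.of_nat n' * stirling1 n' k
  end%Z.

(* Meaningful for n >= 1 only. *)
Definition stirling_term (k n : nat) : R :=
  IZR (stirling1 n (2 * k + 1)) * (-1) ^ n / (INR (fact n) * INR n).

Definition Cinfty : (C -> Prop) -> Prop :=
  fun P => exists M : R, forall z : C, M < Cmod z -> P z.

(* Main.v *)
Require Import Defs.
From Stdlib Require Import Reals Arith Lra Lia ZArith.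
From Coquelicot Require Import Coquelicot.
Open Scope R_scope.

(* Euler-Maclaurin summation on unit cells, with remainders bounded by
   [|x + a|^2 >= x^2 + |a|^2] uniformly up to the imaginary axis, expands
   [lim_M (sum_(n<M) 1/(n+a) - ln (a+M))], which is [gamma_0(a)] by comparing
   the Dirichlet series with [a^(1-s)/(s-1)] as [s] decreases to 1. The
   coefficients are the values at 0 of the Bernoulli polynomials, and the
   Fourier series of these polynomials turns them into zeta(2k+2). Finally the
   inner Stirling sums are [- zeta(2k+2)], because
   [sum_n |s(n,m)|/(n! n) = zeta(m+1)]: this is the duality
   [zeta(1,...,1,2) = zeta(m+1)] of multiple zeta values. *)

(** The outer series diverges for every [a]: its inner sums tend to -1, while [(2k+1)!] outgrows
    every geometric sequence. The formula is therefore an asymptotic expansion, and the constant of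
    the error bound has to be fixed before [a]. The last retained term has order [a^-(2N+2)] and the
    error must be of smaller order, so Euler-Maclaurin is carried to the Bernoulli polynomial of
    index [2N+3]: its value at 0 is 0, so no term is added, but the remainder gains a factor
    [1/|a|]. Two limits meet in gamma_0(a), [s = 1 + t] decreasing to 1 and the cut-off [M] growing.
    They are decoupled by showing that the tail of zeta(1+t, a) from [M] on differs from
    [(a+M)^(-t)/t] by at most [16/M] for all [t] in (0, 1]. This bound survives [t -> 0], and only
    then does [M] grow. The number zeta(2k+2) occurs both in the Bernoulli coefficient and in the
    Stirling sum, so it enters only as the sum of a convergent series and is never evaluated. *)

(* [ring] and [field] reject equations at a type only convertible to [R]. *)
Ltac eq_R := match goal with |- @eq _ ?a ?b => change (@eq R a b) end.

(** * The Stirling sums *)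

(* Unsigned Stirling numbers divided by [n!]; [stirling1] carries the sign
   [(-1)^(n+j)]. *)
Definition ustirling (n j : nat) : R :=
  (-1) ^ (n + j) * IZR (stirling1 n j) / INR (fact n).

Lemma ustirling_0_S (j : nat) : ustirling 0 (S j) = 0.
Proof. unfold ustirling; simpl stirling1; unfold Rdiv; ring. Qed.

Lemma ustirling_0_0 : ustirling 0 0 = 1.
Proof. unfold ustirling; simpl; field. Qed.

Lemma ustirling_S_0 (n : nat) : ustirling (S n) 0 = 0.
Proof.
unfold ustirling.
replace (stirling1 (S n) 0) with 0%Z; [unfold Rdiv; ring |].
induction n as [|n IH]; [reflexivity |].
change (0 = - Z.of_nat (S n) * stirling1 (S n) 0)%Z; rewrite <- IH; ring.
Qed.

Lemma ustirling_SS (n j : nat) :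
  (INR n + 1) * ustirling (S n) (S j) = ustirling n j + INR n * ustirling n (S j).
Proof.
unfold ustirling.
change (stirling1 (S n) (S j))
  with (stirling1 n j - Z.of_nat n * stirling1 n (S j))%Z.
rewrite minus_IZR, mult_IZR, <- INR_IZR_INZ, fact_simpl, mult_INR, S_INR.
replace (S n + S j)%nat with (S (S (n + j))) by lia.
replace (n + S j)%nat with (S (n + j)) by lia.
simpl pow.
pose proof (INR_fact_neq_0 n); pose proof (pos_INR n).
field; split; lra.
Qed.

Lemma ustirling_ge0 (n j : nat) : 0 <= ustirling n j.
Proof.
revert j; induction n as [|n IH]; intros [|j].
- rewrite ustirling_0_0; lra.
- rewrite ustirling_0_S; lra.
- rewrite ustirling_S_0; lra.
- pose proof (ustirling_SS n j); pose proof (pos_INR n).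
  pose proof (IH j); pose proof (IH (S j)).
  assert (0 <= INR n * ustirling n (S j)) by (apply Rmult_le_pos; lra).
  nra.
Qed.

(** The central binomial coefficient [binom(2k, k)] divided by [4^k]. *)
Fixpoint half_binom (k : nat) : R :=
  match k with
  | O => 1
  | S k' => half_binom k' * ((INR k' + / 2) / (INR k' + 1))
  end.

Lemma half_binom_pos (k : nat) : 0 < half_binom k.
Proof.
induction k as [|k IH]; simpl half_binom; [lra |].
pose proof (pos_INR k).
apply Rmult_lt_0_compat; [exact IH |].
apply Rdiv_lt_0_compat; lra.
Qed.

(** Squaring turns the decay rate [k^(-1/2)] into a rational inequality: from one [k] to the next
    the left side is multiplied by [(x+1/2)^2 (x+2) / (x+1)^3], which is at most 1. *)
Lemma half_binom_sqr (k : nat) : half_binom k ^ 2 * (INR k + 1) <= 1.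
Proof.
induction k as [|k IH].
- simpl; lra.
- rewrite S_INR; simpl half_binom.
  pose proof (pos_INR k) as Hk.
  set (x := INR k) in *.
  replace ((half_binom k * ((x + / 2) / (x + 1))) ^ 2 * (x + 1 + 1))
    with (half_binom k ^ 2 * (x + 1) * ((x + / 2) ^ 2 * (x + 2) / (x + 1) ^ 3))
    by (field; lra).
  assert (H3 : 0 < (x + 1) ^ 3) by (apply pow_lt; lra).
  assert (H : (x + / 2) ^ 2 * (x + 2) / (x + 1) ^ 3 <= 1).
  { apply Rle_div_l; [exact H3 | nra]. }
  assert (H0 : 0 <= (x + / 2) ^ 2 * (x + 2) / (x + 1) ^ 3).
  { apply Rdiv_le_0_compat; [nra | exact H3]. }
  pose proof (half_binom_pos k).
  assert (0 <= half_binom k ^ 2 * (x + 1)) by nra.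
  nra.
Qed.

(* The [ustirling n j] are the coefficients of [x (x+1) ... (x+n-1) / n!], which is
   [half_binom n] at [x = 1/2]. *)
Lemma ustirling_le_half_binom (n j : nat) : ustirling n j <= 2 ^ j * half_binom n.
Proof.
revert j; induction n as [|n IH]; intros [|j].
- rewrite ustirling_0_0; simpl; lra.
- rewrite ustirling_0_S; simpl half_binom.
  pose proof (pow_lt 2 (S j)); lra.
- rewrite ustirling_S_0; pose proof (half_binom_pos (S n)); simpl (2 ^ 0); lra.
- pose proof (ustirling_SS n j) as E; pose proof (pos_INR n) as Hn.
  pose proof (IH j) as H1; pose proof (IH (S j)) as H2.
  simpl half_binom; simpl pow in *.
  set (p := 2 ^ j) in *; set (q := half_binom n) in *.
  apply Rmult_le_reg_l with (INR n + 1); [lra |].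
  rewrite E.
  replace ((INR n + 1) * (2 * p * (q * ((INR n + / 2) / (INR n + 1)))))
    with (p * q + INR n * (2 * p * q)) by (field; lra).
  assert (INR n * ustirling n (S j) <= INR n * (2 * p * q))
    by (apply Rmult_le_compat_l; lra).
  lra.
Qed.

Lemma is_lim_seq_half_binom : is_lim_seq half_binom 0.
Proof.
assert (H : is_lim_seq (fun k => / sqrt (INR k + 1)) 0).
{ apply (is_lim_seq_inv _ p_infty); [| easy].
  apply (filterlim_comp _ _ _ (fun k => INR k + 1) sqrt eventually
           (Rbar_locally p_infty)).
  - apply (is_lim_seq_ext (fun n => INR (S n))); [intros; apply S_INR |].
    apply -> is_lim_seq_incr_1; apply is_lim_seq_INR.
  - exact filterlim_sqrt_p. }
apply (is_lim_seq_le_le (fun _ => 0) _ _ _) with (3 := H).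
2: apply is_lim_seq_const.
intros k; pose proof (half_binom_pos k); split; [lra |].
pose proof (pos_INR k).
assert (Hs : 0 < sqrt (INR k + 1)) by (apply sqrt_lt_R0; lra).
apply Rmult_le_reg_r with (sqrt (INR k + 1)); [exact Hs |].
rewrite Rinv_l by lra.
apply Rsqr_incr_0_var; [| lra].
unfold Rsqr.
pose proof (half_binom_sqr k).
pose proof (sqrt_sqrt (INR k + 1)).
nra.
Qed.

(** Decay, not mere boundedness, is what removes the boundary term of the summation by parts in
    [sum_ustirling_conn_parts]. *)
Lemma is_lim_seq_ustirling (j : nat) : is_lim_seq (fun n => ustirling n j) 0.
Proof.
apply (is_lim_seq_le_le (fun _ => 0) _ (fun n => 2 ^ j * half_binom n)).
- intros n; split; [apply ustirling_ge0 | apply ustirling_le_half_binom].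
- apply is_lim_seq_const.
- replace (Finite 0) with (Rbar_mult (2 ^ j) 0)
    by (simpl; rewrite Rmult_0_r; reflexivity).
  apply is_lim_seq_scal_l; exact is_lim_seq_half_binom.
Qed.

(* The connector of Seki and Yamamoto's connected sums. *)
Definition conn (n k : nat) : R := INR (fact n) * INR (fact k) / INR (fact (n + k)).

Lemma conn_pos (n k : nat) : 0 < conn n k.
Proof.
unfold conn; apply Rdiv_lt_0_compat; [apply Rmult_lt_0_compat |];
  apply INR_fact_lt_0.
Qed.

Lemma conn_0_l (k : nat) : conn 0 k = 1.
Proof. unfold conn; simpl; field; apply INR_fact_neq_0. Qed.

Lemma conn_0_r (n : nat) : conn n 0 = 1.
Proof. unfold conn; rewrite Nat.add_0_r; simpl; field; apply INR_fact_neq_0. Qed.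

Lemma conn_S_r (n k : nat) :
  (INR n + INR k + 1) * conn n (S k) = (INR k + 1) * conn n k.
Proof.
unfold conn.
replace (n + S k)%nat with (S (n + k)) by lia.
rewrite !fact_simpl, !mult_INR, !S_INR, plus_INR.
pose proof (INR_fact_neq_0 (n + k)); pose proof (pos_INR n); pose proof (pos_INR k).
field; split; lra.
Qed.

Lemma conn_S_l (n k : nat) :
  (INR n + INR k + 1) * conn (S n) k = (INR n + 1) * conn n k.
Proof.
unfold conn.
replace (S n + k)%nat with (S (n + k)) by lia.
rewrite !fact_simpl, !mult_INR, !S_INR, plus_INR.
pose proof (INR_fact_neq_0 (n + k)); pose proof (pos_INR n); pose proof (pos_INR k).
field; split; lra.
Qed.

(** [conn (S n) k] decreases in [n], starting from [conn 1 k = 1/(k+1)]. The bound absorbs the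
    factor [INR K + 1] of the boundary term below. *)
Lemma conn_le (n k : nat) : conn (S n) k <= / (INR k + 1).
Proof.
pose proof (pos_INR k) as Hk.
induction n as [|n IH].
- pose proof (conn_S_l 0 k) as E; rewrite conn_0_l in E; simpl INR in E.
  apply Req_le; field_simplify_eq; lra.
- apply Rle_trans with (2 := IH).
  pose proof (conn_S_l (S n) k) as E; pose proof (pos_INR (S n)).
  pose proof (conn_pos (S n) k); pose proof (conn_pos (S (S n)) k).
  nra.
Qed.

(** Summation by parts in [k]: the recurrences of [ustirling] and [conn] together trade one unit of
    [j] for a factor [n+1]. *)
Lemma sum_ustirling_conn_parts (n j K : nat) :
  sum_n (fun k => ustirling k j * conn (S n) k) K
  = INR (S n) * sum_n (fun k => ustirling k (S j) * conn (S n) k) K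
    + (INR K + 1) * ustirling (S K) (S j) * conn (S n) K.
Proof.
induction K as [|K IH].
- rewrite !sum_O, ustirling_0_S, conn_0_r.
  pose proof (ustirling_SS 0 j) as E; rewrite ustirling_0_S in E; simpl INR in *; eq_R; nra.
- rewrite !sum_Sn, IH; change (@plus R_AbelianMonoid) with Rplus; eq_R.
  pose proof (ustirling_SS (S K) j) as E1.
  pose proof (conn_S_r (S n) K) as E2.
  set (c1 := conn (S n) (S K)) in *; set (c0 := conn (S n) K) in *.
  rewrite !S_INR in *.
  set (x := INR K) in *; set (y := INR n) in *.
  set (t := ustirling (S K) (S j)) in *.
  assert (E3 : (x + 1) * t * c0 = t * ((y + 1 + x + 1) * c1))
    by (rewrite E2; ring).
  set (s := sum_n _ K) in *.
  nra.
Qed.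

(** This is the coefficient of [x^j] in Gauss's evaluation [2F1(x, 1; n+2; 1) = (n+1)/(n+1-x)]. The
    coefficients are obtained one after the other, each summation by parts giving a factor
    [1/(n+1)]. *)
Lemma is_series_ustirling_conn (n j : nat) :
  is_series (fun k => ustirling k j * conn (S n) k) (/ INR (S n) ^ j).
Proof.
assert (Hn : 0 < INR (S n)) by (apply lt_0_INR; lia).
induction j as [|j IH].
- rewrite pow_O, Rinv_1.
  change (is_lim_seq (sum_n (fun k => ustirling k 0 * conn (S n) k)) 1).
  apply (is_lim_seq_ext (fun _ => 1)); [| apply is_lim_seq_const].
  intros N; induction N as [|N IHN].
  + rewrite sum_O, ustirling_0_0, conn_0_r; ring.
  + rewrite sum_Sn, <- IHN, ustirling_S_0; unfold plus; simpl; ring.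
- change (is_lim_seq (sum_n (fun k => ustirling k (S j) * conn (S n) k))
            (/ INR (S n) ^ S j)).
  apply (is_lim_seq_ext (fun K => / INR (S n) *
    (sum_n (fun k => ustirling k j * conn (S n) k) K
     - (INR K + 1) * ustirling (S K) (S j) * conn (S n) K))).
  { intros K; rewrite sum_ustirling_conn_parts; field; lra. }
  replace (Finite (/ INR (S n) ^ S j))
    with (Rbar_mult (/ INR (S n)) (Finite (/ INR (S n) ^ j - 0)))
    by (clear IH; revert Hn; generalize (INR (S n)); intros v Hv; simpl;
        f_equal; field; split; [apply pow_nonzero |]; lra).
  apply is_lim_seq_scal_l, is_lim_seq_minus'; [exact IH |].
  apply (is_lim_seq_le_le (fun _ => 0) _ (fun K => ustirling (S K) (S j))).
  + intros K; pose proof (ustirling_ge0 (S K) (S j)); pose proof (pos_INR K).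
    pose proof (conn_le n K); pose proof (conn_pos (S n) K).
    assert (Hc : 0 <= (INR K + 1) * conn (S n) K <= 1).
    { split; [apply Rmult_le_pos; lra |].
      apply Rle_trans with ((INR K + 1) * / (INR K + 1));
        [apply Rmult_le_compat_l; lra | rewrite Rinv_r; lra]. }
    replace ((INR K + 1) * ustirling (S K) (S j) * conn (S n) K)
      with (ustirling (S K) (S j) * ((INR K + 1) * conn (S n) K)) by ring.
    split; [apply Rmult_le_pos; lra | nra].
  + apply is_lim_seq_const.
  + apply -> (is_lim_seq_incr_1 (fun K => ustirling K (S j))).
    apply is_lim_seq_ustirling.
Qed.

(** Each term equals [(conn n (S k) - conn (S n) (S k)) / (k+1)], so the sum telescopes from
    [conn 0 (S k) = 1]. *)
Lemma sum_conn_div (N k : nat) :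
  sum_n (fun n => conn (S n) (S k) / INR (S n)) N
  = (1 - conn (S N) (S k)) / INR (S k).
Proof.
pose proof (pos_INR k) as Hk.
induction N as [|N IH].
- rewrite sum_O.
  pose proof (conn_S_l 0 (S k)) as E; rewrite conn_0_l in E.
  rewrite !S_INR in *; simpl INR in *; eq_R.
  field_simplify_eq; lra.
- rewrite sum_Sn, IH; change (@plus R_AbelianMonoid) with Rplus; eq_R.
  pose proof (conn_S_l (S N) (S k)) as E; pose proof (pos_INR N).
  rewrite !S_INR in *.
  field_simplify_eq; lra.
Qed.

(* The case [zeta(m+1) = zeta(1, ..., 1, 2)] of the duality of multiple zeta
   values: insert [1/k = sum_n conn n k / n] and exchange the summations. *)
Lemma is_series_ustirling_div (m : nat) (z : R) :
  is_series (fun n => / INR (S n) ^ (m + 2)) z ->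
  is_series (fun k => ustirling (S k) (S m) / INR (S k)) z.
Proof.
intros Hz.
pose (r := fun N k => ustirling (S k) (S m) * conn (S N) (S k)).
assert (Hr : forall N, is_series (r N) (/ INR (S N) ^ (S m))).
{ intros N.
  apply (is_series_incr_1 (fun k => ustirling k (S m) * conn (S N) k)).
  rewrite ustirling_0_S, Rmult_0_l; unfold plus; simpl plus; rewrite Rplus_0_r.
  apply is_series_ustirling_conn. }
assert (Hs : forall N, is_series
          (fun k => ustirling (S k) (S m) / INR (S k) * (1 - conn (S N) (S k)))
          (sum_n (fun n => / INR (S n) ^ (m + 2)) N)).
{ intros N.
  apply (is_series_ext
    (fun k => sum_n (fun n => scal (/ INR (S n)) (r n k)) N)).
  { intros k; unfold r.
    transitivity (ustirling (S k) (S m) *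
      sum_n (fun n => conn (S n) (S k) / INR (S n)) N).
    - rewrite <- (sum_n_mult_l (K := R_Ring)).
      apply sum_n_ext; intros n.
      assert (E : forall x y w : R, x * (y * w) = y * (w * x)) by (intros; ring).
      exact (E _ _ _).
    - rewrite sum_conn_div; eq_R; field; apply not_0_INR; lia. }
  induction N as [|N IH].
  - rewrite sum_O.
    apply (is_series_ext (fun k => scal (/ INR 1) (r 0%nat k)));
      [intros; now rewrite sum_O |].
    replace (/ INR 1 ^ (m + 2)) with (scal (/ INR 1) (/ INR 1 ^ S m)).
    + apply (is_series_scal_l (K := R_AbsRing) (V := R_NormedModule)), Hr.
    + simpl INR; rewrite !pow1; unfold scal; simpl; unfold mult; simpl; field.
  - apply (is_series_ext (fun k => plus
      (sum_n (fun n => scal (/ INR (S n)) (r n k)) N)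
      (scal (/ INR (S (S N))) (r (S N) k)))); [intros; now rewrite sum_Sn |].
    rewrite sum_Sn.
    apply (is_series_plus (K := R_AbsRing) (V := R_NormedModule)); [exact IH |].
    replace (/ INR (S (S N)) ^ (m + 2))
      with (scal (/ INR (S (S N))) (/ INR (S (S N)) ^ S m)).
    + apply (is_series_scal_l (K := R_AbsRing) (V := R_NormedModule)), Hr.
    + unfold scal; simpl scal; unfold mult; simpl mult.
      replace (m + 2)%nat with (S (S m)) by lia.
      change (INR (S (S N)) ^ S (S m)) with (INR (S (S N)) * INR (S (S N)) ^ S m).
      rewrite Rinv_mult; reflexivity. }
(* The defect of the truncation at [N] is the series of [r N k / INR (S k)]. It is dominated by
   [r N], whose sum is at most [1/(N+1)]. This explicit remainder replaces an exchange of two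
   infinite sums. *)
assert (Hrem : forall N, exists e, 0 <= e <= / INR (S N) /\
  is_series (fun k => ustirling (S k) (S m) / INR (S k))
    (sum_n (fun n => / INR (S n) ^ (m + 2)) N + e)).
{ intros N.
  assert (Hd : forall k, 0 <= r N k / INR (S k) <= r N k).
  { intros k; assert (Hk : 1 <= INR (S k)) by (apply (le_INR 1); lia).
    assert (0 <= r N k).
    { unfold r; apply Rmult_le_pos; [apply ustirling_ge0 | apply Rlt_le, conn_pos]. }
    split; [apply Rdiv_le_0_compat; lra |].
    apply Rle_div_l; [lra | nra]. }
  assert (Hex : ex_series (fun k => r N k / INR (S k))).
  { apply (ex_series_le (K := R_AbsRing) (V := R_CompleteNormedModule)) with (r N).
    - intros k; unfold norm; simpl; unfold abs; simpl.
      rewrite Rabs_pos_eq; apply Hd.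
    - eexists; apply Hr. }
  exists (Series (fun k => r N k / INR (S k))).
  assert (HN : 1 <= INR (S N)) by (apply (le_INR 1); lia).
  split; [split |].
  - rewrite <- (Rmult_0_l (Series (fun _ => 0))), <- Series_scal_l.
    apply Series_le; [| exact Hex].
    intros k; rewrite Rmult_0_l; split; [lra | apply Hd].
  - apply Rle_trans with (Series (r N)).
    + apply Series_le; [exact Hd | eexists; apply Hr].
    + rewrite (is_series_unique _ _ (Hr N)).
      apply Rinv_le_contravar; [lra |].
      rewrite <- (pow_1 (INR (S N))) at 1.
      apply Rle_pow; [exact HN | lia].
  - apply (is_series_ext (fun k => plus
      (ustirling (S k) (S m) / INR (S k) * (1 - conn (S N) (S k)))
      (r N k / INR (S k)))).
    { assert (E : forall x y w : R, w <> 0 -> x / w * (1 - y) + x * y / w = x / w)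
        by (intros; field; assumption).
      intros k; apply E, not_0_INR; lia. }
    apply (is_series_plus (K := R_AbsRing) (V := R_NormedModule)); [apply Hs |].
    apply Series_correct; exact Hex. }
(* The case [N = 0] already gives convergence. The sum [l] is the same for every [N], so the bounds
   on [e] squeeze the partial sums of zeta to it. *)
destruct (Hrem 0%nat) as [e0 [_ H0]].
set (l := sum_n (fun n => / INR (S n) ^ (m + 2)) 0 + e0) in H0.
replace z with l; [exact H0 |].
assert (Hlim : is_lim_seq (sum_n (fun n => / INR (S n) ^ (m + 2))) l).
{ apply (is_lim_seq_le_le (fun N => l - / INR (S N)) _ (fun _ => l)).
  - intros N; destruct (Hrem N) as [e [He HN]].
    set (s := sum_n _ N) in *; clearbody s l.
    assert (E1 : l = s + e)
      by (rewrite <- (is_series_unique _ _ H0); exact (is_series_unique _ _ HN)).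
    split; lra.
  - replace (Finite l) with (Finite (l - 0)) by (f_equal; ring).
    apply is_lim_seq_minus'; [apply is_lim_seq_const |].
    apply (is_lim_seq_inv _ p_infty); [| easy].
    apply -> is_lim_seq_incr_1; apply is_lim_seq_INR.
  - apply is_lim_seq_const. }
pose proof (is_lim_seq_unique _ _ Hlim) as E1.
pose proof (is_lim_seq_unique (sum_n (fun n => / INR (S n) ^ (m + 2))) z Hz) as E2.
congruence.
Qed.

(** The minus sign arises because the lower index is odd: [(-1)^n = - (-1)^(n + 2k + 1)]. *)
Lemma stirling_term_ustirling (k m : nat) :
  stirling_term k (S m) = - (ustirling (S m) (2 * k + 1) / INR (S m)).
Proof.
unfold stirling_term, ustirling.
rewrite (pow_add (-1) (S m) (2 * k + 1)), pow_add, pow_1, pow_1_even.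
pose proof (INR_fact_neq_0 (S m)).
field; split; [assumption | apply not_0_INR; lia].
Qed.

Lemma is_series_stirling_term (k : nat) (z : R) :
  is_series (fun n => / INR (S n) ^ (2 * k + 2)) z ->
  is_series (fun m => stirling_term k (S m)) (- z).
Proof.
intros Hz.
apply (is_series_ext (fun m => opp (ustirling (S m) (S (2 * k)) / INR (S m)))).
{ intros m; rewrite stirling_term_ustirling.
  replace (2 * k + 1)%nat with (S (2 * k)) by lia; reflexivity. }
apply (is_series_opp (K := R_AbsRing) (V := R_NormedModule)).
apply is_series_ustirling_div; exact Hz.
Qed.

(** * Bernoulli polynomials and their values at 0 *)

(* [bern j] is the Bernoulli polynomial [B_j(x)/j!], built by integrating from
   mean value zero. *)
Fixpoint bern (j : nat) : R -> R :=
  match j with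
  | O => fun _ => 1
  | S j' => fun x =>
      RInt (bern j') 0 x - RInt (fun y => RInt (bern j') 0 y) 0 1
  end.

Lemma is_derive_primitive (f : R -> R) (x : R) :
  (forall y, continuous f y) -> is_derive (fun y => RInt f 0 y) x (f x).
Proof.
intros Hf; apply (is_derive_RInt f (fun y => RInt f 0 y) 0 x); [| apply Hf].
apply filter_forall; intros y.
apply (RInt_correct (V := R_CompleteNormedModule)), ex_RInt_continuous; auto.
Qed.

Lemma continuous_bern (j : nat) (x : R) : continuous (bern j) x.
Proof.
revert x; induction j as [|j IH]; intros x; [apply continuous_const |].
simpl; apply (continuous_minus (V := R_NormedModule)); [| apply continuous_const].
apply (ex_derive_continuous (V := R_NormedModule)).
eexists; apply is_derive_primitive; exact IH.
Qed.

Lemma is_derive_bern (j : nat) (x : R) : is_derive (bern (S j)) x (bern j x).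
Proof.
simpl; set (c := RInt _ 0 1).
replace (bern j x) with (minus (bern j x) 0) at 1
  by (unfold minus, plus, opp; simpl; ring).
apply (is_derive_minus (V := R_NormedModule));
  [| apply (is_derive_const (K := R_AbsRing) (V := R_NormedModule))].
apply is_derive_primitive; intros; apply continuous_bern.
Qed.

Lemma ex_RInt_cont (f : R -> R) (a b : R) :
  (forall x, continuous f x) -> ex_RInt f a b.
Proof. intros Hf; apply (ex_RInt_continuous (V := R_CompleteNormedModule)); auto. Qed.

Lemma RInt_plus_R (f g : R -> R) :
  (forall x, continuous f x) -> (forall x, continuous g x) ->
  RInt (fun x => f x + g x) 0 1 = RInt f 0 1 + RInt g 0 1.
Proof.
intros; apply (RInt_plus (V := R_CompleteNormedModule)); apply ex_RInt_cont; assumption.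
Qed.

Lemma RInt_scal_R (c : R) (f : R -> R) :
  (forall x, continuous f x) -> RInt (fun x => c * f x) 0 1 = c * RInt f 0 1.
Proof.
intros; apply (RInt_scal (V := R_CompleteNormedModule)); apply ex_RInt_cont; assumption.
Qed.

Lemma RInt_const_R (c : R) : RInt (fun _ => c) 0 1 = c.
Proof. rewrite RInt_const; unfold scal; simpl; unfold mult; simpl; eq_R; ring. Qed.

Lemma RInt_bern_S (j : nat) : RInt (bern (S j)) 0 1 = 0.
Proof.
simpl; set (c := RInt (fun y => RInt (bern j) 0 y) 0 1).
transitivity (RInt (fun x => RInt (bern j) 0 x + - c) 0 1); [reflexivity |].
rewrite (RInt_plus_R (fun x => RInt (bern j) 0 x) (fun _ => - c)).
- rewrite RInt_const_R; fold c; ring.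
- intros x; apply (ex_derive_continuous (V := R_NormedModule)).
  eexists; apply is_derive_primitive; intros; apply continuous_bern.
- intros; apply continuous_const.
Qed.

Lemma RInt_derive_eq (f df : R -> R) (a b : R) :
  (forall x, is_derive f x (df x)) -> (forall x, continuous df x) ->
  RInt df a b = f b - f a.
Proof.
intros Hf Hdf; apply (is_RInt_unique (V := R_CompleteNormedModule)).
apply (is_RInt_derive (V := R_CompleteNormedModule) f df); auto.
Qed.

(** The increment over the period is the integral of [bern (S j)], which vanishes. [bern 1] is the
    exception: it increases by 1. *)
Lemma bern_1_minus_0 (j : nat) : bern (S (S j)) 1 = bern (S (S j)) 0.
Proof.
pose proof (RInt_derive_eq (bern (S (S j))) (bern (S j)) 0 1
  (is_derive_bern _) (continuous_bern _)) as H.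
rewrite RInt_bern_S in H; lra.
Qed.

Lemma bern_1 (x : R) : bern 1 x = x - / 2.
Proof.
assert (E : forall y, RInt (bern 0) 0 y = y).
{ intros y; simpl; rewrite RInt_const; unfold scal; simpl; unfold mult; simpl; eq_R; ring. }
change (bern 1 x) with (RInt (bern 0) 0 x - RInt (fun y => RInt (bern 0) 0 y) 0 1).
rewrite E; f_equal.
rewrite (RInt_ext _ (fun y => y)) by (intros; apply E).
rewrite (RInt_derive_eq (fun y => y ^ 2 / 2) (fun y => y)).
- eq_R; field.
- intros y; auto_derive; [exact I | field].
- intros y; apply continuous_id.
Qed.

Lemma bern_bounded (j : nat) : exists B, forall x, 0 <= x <= 1 -> Rabs (bern j x) <= B.
Proof.
destruct (continuity_ab_maj (fun x => Rabs (bern j x)) 0 1) as [m [Hm _]]; [lra | |].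
- intros c _; apply continuity_pt_filterlim.
  apply (continuous_comp (bern j) Rabs); [apply continuous_bern |].
  apply continuity_pt_filterlim, Rcontinuity_abs.
- exists (Rabs (bern j m)); exact Hm.
Qed.

(** * Dirichlet and Fejer kernels, and Fourier series at 0 *)

(* The final [- 2] corrects the term [n = 0] of the sum. *)
Definition dirichlet (M : nat) (x : R) : R :=
  1 + 2 * sum_f_R0 (fun n => cos (2 * PI * INR n * x)) M - 2.

(** Not normalised: the usual Fejer kernel is this divided by [K + 1]. *)
Definition fejer (K : nat) (x : R) : R := sum_f_R0 (fun M => dirichlet M x) K.

Lemma dirichlet_0 (x : R) : dirichlet 0 x = 1.
Proof.
unfold dirichlet; simpl.
replace (2 * PI * 0 * x) with 0 by ring; rewrite cos_0; ring.
Qed.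

Lemma dirichlet_S (M : nat) (x : R) :
  dirichlet (S M) x = dirichlet M x + 2 * cos (2 * PI * INR (S M) * x).
Proof. unfold dirichlet; rewrite tech5; ring. Qed.

(** The closed form is kept multiplied out, so that it holds also where the sine vanishes. *)
Lemma sin_mul_dirichlet (M : nat) (x : R) :
  sin (PI * x) * dirichlet M x = sin ((2 * INR M + 1) * (PI * x)).
Proof.
induction M as [|M IH].
- rewrite dirichlet_0.
  replace ((2 * INR 0 + 1) * (PI * x)) with (PI * x) by (simpl; ring); ring.
- rewrite dirichlet_S, Rmult_plus_distr_l, IH, S_INR.
  replace ((2 * INR M + 1) * (PI * x))
    with (2 * PI * (INR M + 1) * x - PI * x) by ring.
  replace ((2 * (INR M + 1) + 1) * (PI * x))
    with (2 * PI * (INR M + 1) * x + PI * x) by ring.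
  rewrite sin_plus, sin_minus; ring.
Qed.

(** The induction step is [sin t * sin (2u + t) = sin (u + t) ^ 2 - sin u ^ 2]. *)
Lemma sin_sqr_mul_fejer (K : nat) (x : R) :
  sin (PI * x) ^ 2 * fejer K x = sin ((INR K + 1) * (PI * x)) ^ 2.
Proof.
unfold fejer; induction K as [|K IH].
- simpl sum_f_R0; rewrite dirichlet_0.
  replace ((INR 0 + 1) * (PI * x)) with (PI * x) by (simpl; ring); ring.
- rewrite tech5, Rmult_plus_distr_l, IH.
  replace (sin (PI * x) ^ 2 * dirichlet (S K) x)
    with (sin (PI * x) * (sin (PI * x) * dirichlet (S K) x)) by ring.
  rewrite sin_mul_dirichlet, S_INR.
  set (t := PI * x); set (u := (INR K + 1) * t).
  replace ((2 * (INR K + 1) + 1) * t) with (u + (u + t)) by (unfold u; ring).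
  replace ((INR K + 1 + 1) * t) with (u + t) by (unfold u; ring).
  rewrite !sin_plus, !cos_plus.
  pose proof (sin2_cos2 u) as E1; pose proof (sin2_cos2 t) as E2; unfold Rsqr in *.
  set (su := sin u) in *; set (cu := cos u) in *.
  set (st := sin t) in *; set (ct := cos t) in *.
  transitivity (su ^ 2 * (st * st + ct * ct)
                + st * (su * (cu * ct - su * st) + cu * (su * ct + cu * st)));
    [rewrite E2 |]; ring.
Qed.

Lemma continuous_dirichlet (M : nat) (x : R) : continuous (dirichlet M) x.
Proof.
induction M as [|M IH].
- apply (continuous_ext (fun _ => 1)); [intros; now rewrite dirichlet_0 |].
  apply continuous_const.
- apply (continuous_ext (fun y => dirichlet M y + 2 * cos (2 * PI * INR (S M) * y)));
    [intros; now rewrite dirichlet_S |].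
  apply (continuous_plus (V := R_NormedModule)); [exact IH |].
  apply (ex_derive_continuous (V := R_NormedModule)); auto_derive; exact I.
Qed.

Lemma continuous_fejer (K : nat) (x : R) : continuous (fejer K) x.
Proof.
induction K as [|K IH]; [apply continuous_dirichlet |].
apply (continuous_plus (V := R_NormedModule)); [exact IH | apply continuous_dirichlet].
Qed.

Lemma continuous_mult_R (f g : R -> R) (x : R) :
  continuous f x -> continuous g x -> continuous (fun y => f y * g y) x.
Proof. intros; apply (continuous_mult (K := R_AbsRing)); assumption. Qed.

Lemma continuous_cos_freq (w x : R) : continuous (fun y => cos (w * y)) x.
Proof. apply (ex_derive_continuous (V := R_NormedModule)); auto_derive; exact I. Qed.

Lemma continuous_sin_freq (w x : R) : continuous (fun y => sin (w * y)) x.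
Proof. apply (ex_derive_continuous (V := R_NormedModule)); auto_derive; exact I. Qed.

Lemma sin_2PI_nat (n : nat) : sin (2 * PI * INR n) = 0.
Proof.
replace (2 * PI * INR n) with (0 + 2 * INR n * PI) by ring.
rewrite sin_period; exact sin_0.
Qed.

Lemma cos_2PI_nat (n : nat) : cos (2 * PI * INR n) = 1.
Proof.
replace (2 * PI * INR n) with (0 + 2 * INR n * PI) by ring.
rewrite cos_period; exact cos_0.
Qed.

Lemma is_derive_sin_freq (w x : R) :
  w <> 0 -> is_derive (fun y => sin (w * y) / w) x (cos (w * x)).
Proof. intros Hw; auto_derive; [exact I | field; exact Hw]. Qed.

Lemma is_derive_cos_freq (w x : R) :
  w <> 0 -> is_derive (fun y => - cos (w * y) / w) x (sin (w * x)).
Proof. intros Hw; auto_derive; [exact I | field; exact Hw]. Qed.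

Lemma freq_neq_0 (n : nat) : 2 * PI * INR (S n) <> 0.
Proof.
pose proof PI_RGT_0; assert (0 < INR (S n)) by (apply lt_0_INR; lia); nra.
Qed.

Lemma RInt_cos_freq (n : nat) : RInt (fun x => cos (2 * PI * INR (S n) * x)) 0 1 = 0.
Proof.
pose proof (freq_neq_0 n) as Hw.
rewrite (RInt_derive_eq
  (fun x => sin (2 * PI * INR (S n) * x) / (2 * PI * INR (S n)))).
- rewrite Rmult_1_r, Rmult_0_r, sin_2PI_nat, sin_0; lra.
- intros x; apply is_derive_sin_freq; exact Hw.
- intros x; apply continuous_cos_freq.
Qed.

Lemma RInt_sin_freq (n : nat) : RInt (fun x => sin (2 * PI * INR (S n) * x)) 0 1 = 0.
Proof.
pose proof (freq_neq_0 n) as Hw.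
rewrite (RInt_derive_eq
  (fun x => - cos (2 * PI * INR (S n) * x) / (2 * PI * INR (S n)))).
- rewrite Rmult_1_r, Rmult_0_r, cos_2PI_nat, cos_0; lra.
- intros x; apply is_derive_cos_freq; exact Hw.
- intros x; apply continuous_sin_freq.
Qed.

(** The right side is the partial sum, evaluated at 0, of the Fourier series of [g]. *)
Lemma RInt_mul_dirichlet (g : R -> R) (M : nat) :
  (forall x, continuous g x) ->
  RInt (fun x => g x * dirichlet M x) 0 1 =
  RInt g 0 1 + 2 * (sum_f_R0 (fun n => RInt (fun x => g x * cos (2 * PI * INR n * x)) 0 1) M
                    - RInt g 0 1).
Proof.
intros Hg; induction M as [|M IH].
- rewrite (RInt_ext _ g).
  2: intros; rewrite dirichlet_0; apply Rmult_1_r.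
  simpl sum_f_R0.
  rewrite (RInt_ext (fun x => g x * cos (2 * PI * INR 0 * x)) g); [symmetry; eq_R; ring |].
  intros x _; simpl INR; replace (2 * PI * 0 * x) with 0 by ring; rewrite cos_0.
  apply Rmult_1_r.
- rewrite tech5.
  rewrite (RInt_ext _ (fun x => g x * dirichlet M x
            + 2 * (g x * cos (2 * PI * INR (S M) * x)))).
  2: intros; rewrite dirichlet_S; eq_R; ring.
  rewrite RInt_plus_R, RInt_scal_R, IH; [eq_R; ring | | |].
  + intros; apply continuous_mult_R; [apply Hg | apply continuous_cos_freq].
  + intros; apply continuous_mult_R; [apply Hg | apply continuous_dirichlet].
  + intros; apply continuous_mult_R; [apply continuous_const |].
    apply continuous_mult_R; [apply Hg | apply continuous_cos_freq].
Qed.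

Lemma RInt_mul_fejer (g : R -> R) (K : nat) :
  (forall x, continuous g x) ->
  RInt (fun x => g x * fejer K x) 0 1 =
  sum_f_R0 (fun M => RInt (fun x => g x * dirichlet M x) 0 1) K.
Proof.
intros Hg; induction K as [|K IH]; [reflexivity |].
rewrite tech5, <- IH, <- RInt_plus_R.
- apply RInt_ext; intros x _; unfold fejer; rewrite tech5; eq_R; ring.
- intros; apply continuous_mult_R; [apply Hg | apply continuous_fejer].
- intros; apply continuous_mult_R; [apply Hg | apply continuous_dirichlet].
Qed.

Lemma RInt_fejer (K : nat) : RInt (fejer K) 0 1 = INR (S K).
Proof.
transitivity (RInt (fun x => 1 * fejer K x) 0 1).
{ apply RInt_ext; intros; eq_R; ring. }
rewrite (RInt_mul_fejer (fun _ => 1)) by (intros; apply continuous_const).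
rewrite (sum_eq _ (fun _ => 1)).
{ rewrite sum_cte; eq_R; ring. }
intros M _; rewrite (RInt_mul_dirichlet (fun _ => 1)) by (intros; apply continuous_const).
rewrite !RInt_const_R.
rewrite (sum_eq _ (fun n => match n with O => 1 | _ => 0 end)).
- replace (sum_f_R0 _ M) with 1; [eq_R; ring |].
  induction M as [|M IH]; [reflexivity | rewrite tech5, <- IH; ring].
- intros [|n] _.
  + rewrite (RInt_ext _ (fun _ => 1)); [apply RInt_const_R |].
    intros x _; simpl INR; replace (2 * PI * 0 * x) with 0 by ring.
    rewrite cos_0; apply Rmult_1_r.
  + rewrite (RInt_ext _ (fun x => cos (2 * PI * INR (S n) * x))).
    * apply RInt_cos_freq.
    * intros; apply Rmult_1_l.
Qed.

Lemma sin_PI_mul_pos (x : R) : 0 < x < 1 -> 0 < sin (PI * x).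
Proof. intros Hx; pose proof PI_RGT_0; apply sin_gt_0; nra. Qed.

Lemma fejer_ge0 (K : nat) (x : R) : 0 < x < 1 -> 0 <= fejer K x.
Proof.
intros Hx; pose proof (sin_PI_mul_pos x Hx); pose proof (sin_sqr_mul_fejer K x) as E.
assert (0 < sin (PI * x) ^ 2) by (apply pow_lt; assumption).
pose proof (pow2_ge_0 (sin ((INR K + 1) * (PI * x)))); nra.
Qed.

(** Near the endpoints [p] is small by continuity. Between them the sine has a positive minimum, and
    [C] is the maximum of [|p|] divided by the square of that minimum. A bound of this shape can be
    integrated against [fejer] without splitting the interval. *)
Lemma continuous_ends_bound (p : R -> R) (eps : R) :
  (forall x, continuous p x) -> p 0 = 0 -> p 1 = 0 -> 0 < eps ->
  exists C, 0 <= C /\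
    forall x, 0 < x < 1 -> Rabs (p x) <= eps + C * sin (PI * x) ^ 2.
Proof.
intros Hp H0 H1 He.
destruct (proj1 (filterlim_locally p (p 0)) (Hp 0) (mkposreal _ He)) as [d0 Hd0].
destruct (proj1 (filterlim_locally p (p 1)) (Hp 1) (mkposreal _ He)) as [d1 Hd1].
rewrite H0 in Hd0; rewrite H1 in Hd1.
(* The cap [/ 2] keeps the interval from [d] to [1 - d] nonempty for the minimum taken below. *)
set (d := Rmin (Rmin d0 d1) (/ 2)).
assert (Hd : 0 < d <= / 2 /\ d <= d0 /\ d <= d1).
{ pose proof (cond_pos d0); pose proof (cond_pos d1); unfold d.
  pose proof (Rmin_l (Rmin d0 d1) (/ 2)); pose proof (Rmin_r (Rmin d0 d1) (/ 2)).
  pose proof (Rmin_l d0 d1); pose proof (Rmin_r d0 d1).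
  repeat split; try lra; repeat apply Rmin_pos; lra. }
destruct (continuity_ab_maj (fun x => Rabs (p x)) 0 1) as [m [Hm _]]; [lra | |].
{ intros c _; apply continuity_pt_filterlim.
  apply (continuous_comp p Rabs); [apply Hp |].
  apply continuity_pt_filterlim, Rcontinuity_abs. }
destruct (continuity_ab_min (fun x => sin (PI * x)) d (1 - d)) as [y [Hy Hy']]; [lra | |].
{ intros c _; apply continuity_pt_filterlim, continuous_sin_freq. }
assert (Hs : 0 < sin (PI * y)) by (apply sin_PI_mul_pos; lra).
assert (HB : 0 <= Rabs (p m)) by apply Rabs_pos.
exists (Rabs (p m) / sin (PI * y) ^ 2).
assert (Hs2 : 0 < sin (PI * y) ^ 2) by (apply pow_lt; exact Hs).
assert (HC : 0 <= Rabs (p m) / sin (PI * y) ^ 2) by (apply Rdiv_le_0_compat; assumption).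
split; [exact HC |].
intros x Hx.
assert (Hx2 : 0 <= Rabs (p m) / sin (PI * y) ^ 2 * sin (PI * x) ^ 2)
  by (apply Rmult_le_pos; [exact HC | apply pow2_ge_0]).
destruct (Rlt_le_dec x d) as [Hlt|Hge].
{ specialize (Hd0 x).
  assert (Hb : ball 0 d0 x).
  { unfold ball; simpl; unfold AbsRing_ball, abs, minus, plus, opp; simpl.
    rewrite Rabs_pos_eq; lra. }
  specialize (Hd0 Hb); unfold ball in Hd0; simpl in Hd0.
  unfold AbsRing_ball, abs, minus, plus, opp in Hd0; simpl in Hd0.
  rewrite Ropp_0, Rplus_0_r in Hd0; lra. }
destruct (Rlt_le_dec (1 - d) x) as [Hlt|Hle].
{ specialize (Hd1 x).
  assert (Hb : ball 1 d1 x).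
  { unfold ball; simpl; unfold AbsRing_ball, abs, minus, plus, opp; simpl.
    rewrite Rabs_left; lra. }
  specialize (Hd1 Hb); unfold ball in Hd1; simpl in Hd1.
  unfold AbsRing_ball, abs, minus, plus, opp in Hd1; simpl in Hd1.
  rewrite Ropp_0, Rplus_0_r in Hd1; lra. }
assert (Hle2 : sin (PI * y) ^ 2 <= sin (PI * x) ^ 2).
{ apply pow_incr; split; [lra | apply Hy; lra]. }
apply Rle_trans with (Rabs (p m)); [apply Hm; lra |].
assert (E : Rabs (p m) / sin (PI * y) ^ 2 * sin (PI * y) ^ 2 = Rabs (p m)) by (field; lra).
assert (Rabs (p m) / sin (PI * y) ^ 2 * sin (PI * y) ^ 2
        <= Rabs (p m) / sin (PI * y) ^ 2 * sin (PI * x) ^ 2)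
  by (apply Rmult_le_compat_l; assumption).
lra.
Qed.

(* [sin (PI x) ^ 2] cancels the denominator of the Fejer kernel, so its
   contribution stays bounded as [K] grows. *)
Lemma RInt_fejer_upper (p : R -> R) (eps C : R) (K : nat) :
  (forall x, continuous p x) -> 0 <= C ->
  (forall x, 0 < x < 1 -> p x <= eps + C * sin (PI * x) ^ 2) ->
  RInt (fun x => p x * fejer K x) 0 1 <= eps * INR (S K) + C.
Proof.
intros Hp HC Hb.
replace (eps * INR (S K) + C) with (RInt (fun x => eps * fejer K x + C) 0 1).
- apply RInt_le; [lra | | |].
  + apply ex_RInt_cont; intros; apply continuous_mult_R; [apply Hp | apply continuous_fejer].
  + apply ex_RInt_cont; intros; apply (continuous_plus (V := R_NormedModule));
      [| apply continuous_const].
    apply continuous_mult_R; [apply continuous_const | apply continuous_fejer].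
  + intros x Hx; pose proof (fejer_ge0 K x Hx) as Hf.
    pose proof (Rmult_le_compat_r _ _ _ Hf (Hb x Hx)) as H.
    rewrite Rmult_plus_distr_r, Rmult_assoc, sin_sqr_mul_fejer in H.
    pose proof (SIN_bound ((INR K + 1) * (PI * x))) as Hs.
    assert (sin ((INR K + 1) * (PI * x)) ^ 2 <= 1) by nra.
    nra.
- rewrite (RInt_plus_R (fun x => eps * fejer K x) (fun _ => C)), RInt_scal_R,
    RInt_fejer, RInt_const_R;
    [reflexivity | apply continuous_fejer | | intros; apply continuous_const].
  intros; apply continuous_mult_R; [apply continuous_const | apply continuous_fejer].
Qed.

(* Fejer's theorem suffices, as the limit of a sequence is that of its Cesaro
   means. *)
Lemma fourier_series_at_0 (g : R -> R) (l : R) :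
  (forall x, continuous g x) -> g 1 = g 0 ->
  is_lim_seq (fun M => RInt (fun x => g x * dirichlet M x) 0 1) l -> l = g 0.
Proof.
intros Hg Hper Hl.
set (A := fun M => RInt (fun x => g x * dirichlet M x) 0 1) in Hl.
assert (Hces : is_lim_seq (fun n => sum_f_R0 A n / INR (S n)) l).
{ apply is_lim_seq_Reals.
  apply is_lim_seq_Reals in Hl.
  pose proof (Cesaro_1 A l Hl) as H.
  apply is_lim_seq_Reals in H; apply is_lim_seq_incr_1 in H.
  apply is_lim_seq_Reals; exact H. }
assert (Hinv : is_lim_seq (fun n => / INR (S n)) 0).
{ apply (is_lim_seq_inv _ p_infty); [| easy].
  apply -> is_lim_seq_incr_1; apply is_lim_seq_INR. }
assert (Hp : forall x, continuous (fun y => g y - g 0) x).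
{ intros; apply (continuous_minus (V := R_NormedModule)); [apply Hg | apply continuous_const]. }
assert (Hn : forall x, continuous (fun y => - (g y - g 0)) x).
{ intros; apply (continuous_opp (V := R_NormedModule)); apply Hp. }
(* The kernel has mass [INR (S n)], so what remains is the integral of a function that vanishes at
   both endpoints, thanks to [g 1 = g 0]. *)
assert (Hsplit : forall n, sum_f_R0 A n = g 0 * INR (S n)
                  + RInt (fun x => (g x - g 0) * fejer n x) 0 1).
{ intros n; unfold A; rewrite <- RInt_mul_fejer by exact Hg.
  rewrite <- RInt_fejer, <- RInt_scal_R by apply continuous_fejer.
  rewrite <- RInt_plus_R.
  - apply RInt_ext; intros; eq_R; ring.
  - intros; apply continuous_mult_R; [apply continuous_const | apply continuous_fejer].
  - intros; apply continuous_mult_R; [apply Hp | apply continuous_fejer]. }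
assert (Hup : forall eps, 0 < eps -> l <= g 0 + eps /\ g 0 - eps <= l).
{ intros eps He.
  destruct (continuous_ends_bound (fun y => g y - g 0) eps Hp) as [C [HC Hb]];
    [ring | rewrite Hper; ring | exact He |].
  assert (Hlim : forall s, is_lim_seq (fun n => s + C * / INR (S n)) s).
  { intros s; replace (Finite s) with (Finite (s + C * 0)) by (f_equal; ring).
    apply is_lim_seq_plus'; [apply is_lim_seq_const |].
    apply (is_lim_seq_scal_l _ C 0); exact Hinv. }
  assert (Hlim' : forall s, is_lim_seq (fun n => s - C * / INR (S n)) s).
  { intros s; replace (Finite s) with (Finite (s - C * 0)) by (f_equal; ring).
    apply is_lim_seq_minus'; [apply is_lim_seq_const |].
    apply (is_lim_seq_scal_l _ C 0); exact Hinv. }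
  split.
  - refine (is_lim_seq_le _ _ l (g 0 + eps) _ Hces (Hlim (g 0 + eps))).
    intros n; rewrite Hsplit.
    pose proof (RInt_fejer_upper _ eps C n Hp HC) as H.
    assert (HS : 0 < INR (S n)) by (apply lt_0_INR; lia).
    apply Rle_div_l; [exact HS |].
    replace ((g 0 + eps + C * / INR (S n)) * INR (S n))
      with (g 0 * INR (S n) + (eps * INR (S n) + C)) by (field; lra).
    apply Rplus_le_compat_l, H.
    intros x Hx; apply Rle_trans with (2 := Hb x Hx), Rle_abs.
  - refine (is_lim_seq_le _ _ (g 0 - eps) l _ (Hlim' (g 0 - eps)) Hces).
    intros n; rewrite Hsplit.
    pose proof (RInt_fejer_upper _ eps C n Hn HC) as H.
    assert (HS : 0 < INR (S n)) by (apply lt_0_INR; lia).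
    apply Rle_div_r; [exact HS |].
    replace ((g 0 - eps - C * / INR (S n)) * INR (S n))
      with (g 0 * INR (S n) - (eps * INR (S n) + C)) by (field; lra).
    assert (E : RInt (fun x => - (g x - g 0) * fejer n x) 0 1
                = -1 * RInt (fun x => (g x - g 0) * fejer n x) 0 1).
    { rewrite <- RInt_scal_R.
      - apply RInt_ext; intros; eq_R; ring.
      - intros; apply continuous_mult_R; [apply Hp | apply continuous_fejer]. }
    cbv beta in H; rewrite E in H.
    enough (-1 * RInt (fun x => (g x - g 0) * fejer n x) 0 1 <= eps * INR (S n) + C) by lra.
    apply H; intros x Hx; apply Rle_trans with (2 := Hb x Hx).
    rewrite <- Rabs_Ropp; apply Rle_abs. }
apply Rle_antisym; apply Rnot_lt_le; intros Hlt.
- pose proof (Hup ((l - g 0) / 2)); lra.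
- pose proof (Hup ((g 0 - l) / 2)); lra.
Qed.

(** * Fourier coefficients of the Bernoulli polynomials *)

Definition bern_cos (j n : nat) : R :=
  RInt (fun x => bern j x * cos (2 * PI * INR (S n) * x)) 0 1.

Definition bern_sin (j n : nat) : R :=
  RInt (fun x => bern j x * sin (2 * PI * INR (S n) * x)) 0 1.

Lemma is_derive_mult_R (f g : R -> R) (x df dg : R) :
  is_derive f x df -> is_derive g x dg ->
  is_derive (fun y => f y * g y) x (df * g x + f x * dg).
Proof.
intros Hf Hg; apply (is_derive_mult (K := R_AbsRing) f g); [exact Hf | exact Hg |].
intros; apply Rmult_comm.
Qed.

Lemma RInt_bern_parts (j : nat) (h dh : R -> R) :
  (forall x, is_derive h x (dh x)) ->
  (forall x, continuous h x) -> (forall x, continuous dh x) ->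
  RInt (fun x => bern j x * h x) 0 1 + RInt (fun x => bern (S j) x * dh x) 0 1
  = bern (S j) 1 * h 1 - bern (S j) 0 * h 0.
Proof.
intros Hh Hc Hdc.
assert (C1 : forall x, continuous (fun y => bern j y * h y) x)
  by (intros; apply continuous_mult_R; [apply continuous_bern | apply Hc]).
assert (C2 : forall x, continuous (fun y => bern (S j) y * dh y) x)
  by (intros; apply continuous_mult_R; [apply continuous_bern | apply Hdc]).
rewrite <- RInt_plus_R by assumption.
apply (RInt_derive_eq (fun x => bern (S j) x * h x)).
- intros x; apply is_derive_mult_R; [apply is_derive_bern | apply Hh].
- intros x; apply (continuous_plus (V := R_NormedModule)); [apply C1 | apply C2].
Qed.

Lemma bern_cos_S (j n : nat) :
  bern_cos (S j) n = - bern_sin j n / (2 * PI * INR (S n)).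
Proof.
pose proof (freq_neq_0 n) as Hw; unfold bern_cos, bern_sin.
pose proof (sin_2PI_nat (S n)) as E0.
set (w := 2 * PI * INR (S n)) in *.
pose proof (RInt_bern_parts j (fun x => sin (w * x) / w) (fun x => cos (w * x))) as E.
assert (E1 : RInt (fun x => bern j x * (sin (w * x) / w)) 0 1
             = / w * RInt (fun x => bern j x * sin (w * x)) 0 1).
{ rewrite <- RInt_scal_R.
  - apply RInt_ext; intros; unfold Rdiv; eq_R; ring.
  - intros; apply continuous_mult_R; [apply continuous_bern | apply continuous_sin_freq]. }
cbv beta in E; rewrite E1, Rmult_1_r, Rmult_0_r, E0, sin_0 in E.
apply Rplus_eq_reg_l with (/ w * RInt (fun x => bern j x * sin (w * x)) 0 1).
rewrite E; [field; exact Hw | | |].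
- intros; apply is_derive_sin_freq; exact Hw.
- intros; apply continuous_mult_R; [apply continuous_sin_freq | apply continuous_const].
- intros; apply continuous_cos_freq.
Qed.

(** The boundary term is the increment of [bern (S j)] over the period: 1 for [j = 0] and 0 from
    then on. Every nonzero cosine coefficient originates in that single increment. *)
Lemma bern_sin_S (j n : nat) :
  bern_sin (S j) n
  = (bern_cos j n - (bern (S j) 1 - bern (S j) 0)) / (2 * PI * INR (S n)).
Proof.
pose proof (freq_neq_0 n) as Hw; unfold bern_cos, bern_sin.
pose proof (cos_2PI_nat (S n)) as E0.
set (w := 2 * PI * INR (S n)) in *.
pose proof (RInt_bern_parts j (fun x => - cos (w * x) / w) (fun x => sin (w * x))) as E.
assert (E1 : RInt (fun x => bern j x * (- cos (w * x) / w)) 0 1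
             = - / w * RInt (fun x => bern j x * cos (w * x)) 0 1).
{ rewrite <- RInt_scal_R.
  - apply RInt_ext; intros; unfold Rdiv; eq_R; ring.
  - intros; apply continuous_mult_R; [apply continuous_bern | apply continuous_cos_freq]. }
cbv beta in E; rewrite E1, Rmult_1_r, Rmult_0_r, E0, cos_0 in E.
apply Rplus_eq_reg_l with (- / w * RInt (fun x => bern j x * cos (w * x)) 0 1).
rewrite E; [field; exact Hw | | |].
- intros; apply is_derive_cos_freq; exact Hw.
- intros; apply continuous_mult_R; [| apply continuous_const].
  apply (continuous_opp (V := R_NormedModule)), continuous_cos_freq.
- intros; apply continuous_sin_freq.
Qed.

Lemma bern_cos_1 (n : nat) : bern_cos 1 n = 0.
Proof.
rewrite bern_cos_S; unfold bern_sin; simpl bern.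
rewrite (RInt_ext _ (fun x => sin (2 * PI * INR (S n) * x))).
- rewrite RInt_sin_freq; unfold Rdiv; ring.
- intros; apply Rmult_1_l.
Qed.

Lemma bern_cos_2 (n : nat) : bern_cos 2 n = / (2 * PI * INR (S n)) ^ 2.
Proof.
rewrite bern_cos_S, bern_sin_S, !bern_1.
assert (E : bern_cos 0 n = 0).
{ unfold bern_cos; simpl bern.
  rewrite (RInt_ext _ (fun x => cos (2 * PI * INR (S n) * x))).
  - apply RInt_cos_freq.
  - intros; apply Rmult_1_l. }
rewrite E; pose proof (freq_neq_0 n).
set (w := 2 * PI * INR (S n)) in *; clearbody w; field; assumption.
Qed.

Lemma bern_cos_SSS (j n : nat) :
  bern_cos (S (S (S j))) n = - bern_cos (S j) n / (2 * PI * INR (S n)) ^ 2.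
Proof.
rewrite (bern_cos_S (S (S j))), bern_sin_S, bern_1_minus_0.
pose proof (freq_neq_0 n).
set (w := 2 * PI * INR (S n)) in *; clearbody w; field; assumption.
Qed.

Lemma bern_cos_odd (k n : nat) : bern_cos (2 * k + 1) n = 0.
Proof.
induction k as [|k IH]; [apply bern_cos_1 |].
replace (2 * S k + 1)%nat with (S (S (S (2 * k)))) by lia.
rewrite bern_cos_SSS.
replace (S (2 * k)) with (2 * k + 1)%nat by lia.
rewrite IH; unfold Rdiv; ring.
Qed.

Lemma bern_cos_even (k n : nat) :
  bern_cos (2 * k + 2) n = (-1) ^ k / (2 * PI * INR (S n)) ^ (2 * k + 2).
Proof.
pose proof (freq_neq_0 n) as Hw.
induction k as [|k IH].
- rewrite bern_cos_2; simpl (2 * 0 + 2)%nat; simpl ((-1) ^ 0); unfold Rdiv; ring.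
- replace (2 * S k + 2)%nat with (S (S (S (2 * k + 1)))) by lia.
  rewrite bern_cos_SSS.
  replace (S (2 * k + 1)) with (2 * k + 2)%nat by lia.
  rewrite IH.
  replace (S (S (2 * k + 2))) with (2 + (2 * k + 2))%nat by lia.
  rewrite (pow_add _ 2 (2 * k + 2)); change ((-1) ^ S k) with (-1 * (-1) ^ k).
  set (w := 2 * PI * INR (S n)) in *; clearbody w.
  field; split; [apply pow_nonzero |]; exact Hw.
Qed.

(** From index 2 on the endpoint values agree, as [fourier_series_at_0] requires, and the zero mean
    value removes the constant coefficient. The factor 2 counts the frequencies of both signs. *)
Lemma bern_at_0 (j : nat) (l : R) :
  is_series (bern_cos (S (S j))) l -> bern (S (S j)) 0 = 2 * l.
Proof.
intros Hl; symmetry.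
apply fourier_series_at_0; [apply continuous_bern | apply bern_1_minus_0 |].
apply (is_lim_seq_incr_1 (fun M => RInt (fun x => bern (S (S j)) x * dirichlet M x) 0 1)).
apply (is_lim_seq_ext (fun M => 2 * sum_n (bern_cos (S (S j))) M)).
- intros M; rewrite RInt_mul_dirichlet by apply continuous_bern.
  rewrite RInt_bern_S, decomp_sum by lia; simpl pred.
  rewrite sum_n_Reals, (RInt_ext _ (bern (S (S j)))).
  + rewrite RInt_bern_S; unfold bern_cos; ring.
  + intros x _; simpl INR; replace (2 * PI * 0 * x) with 0 by ring.
    rewrite cos_0; apply Rmult_1_r.
- apply (is_lim_seq_scal_l _ 2 l); exact Hl.
Qed.

Lemma bern_odd_at_0 (k : nat) : bern (2 * k + 3) 0 = 0.
Proof.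
replace (2 * k + 3)%nat with (S (S (2 * k + 1))) by lia.
rewrite (bern_at_0 _ 0); [ring |].
apply (is_series_ext (fun _ => 0)).
- intros n; replace (S (S (2 * k + 1))) with (2 * S k + 1)%nat by lia.
  symmetry; apply bern_cos_odd.
- change (is_lim_seq (sum_n (fun _ => 0)) 0).
  apply (is_lim_seq_ext (fun _ => 0)); [| apply is_lim_seq_const].
  intros n; rewrite sum_n_const, Rmult_0_r; reflexivity.
Qed.

Lemma bern_even_at_0 (k : nat) (z : R) :
  is_series (fun n => / INR (S n) ^ (2 * k + 2)) z ->
  bern (2 * k + 2) 0 = 2 * ((-1) ^ k / (2 * PI) ^ (2 * k + 2) * z).
Proof.
intros Hz.
replace (2 * k + 2)%nat with (S (S (2 * k))) at 1 by lia.
apply bern_at_0.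
apply (is_series_ext (fun n =>
  scal ((-1) ^ k / (2 * PI) ^ (2 * k + 2)) (/ INR (S n) ^ (2 * k + 2)))).
- intros n; replace (S (S (2 * k))) with (2 * k + 2)%nat by lia.
  rewrite bern_cos_even, (Rpow_mult_distr (2 * PI)).
  unfold Rdiv; rewrite Rinv_mult, <- Rmult_assoc; reflexivity.
- apply (is_series_scal_l (K := R_AbsRing) (V := R_NormedModule)); exact Hz.
Qed.

Lemma ex_series_zeta (k : nat) : ex_series (fun n => / INR (S n) ^ (2 * k + 2)).
Proof.
apply (ex_series_le (K := R_AbsRing) (V := R_CompleteNormedModule)) with
  (fun n => 2 * (/ INR (S n) - / INR (S (S n)))).
- intros n; change (Rabs (/ INR (S n) ^ (2 * k + 2)) <= 2 * (/ INR (S n) - / INR (S (S n)))).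
  assert (Hn : 1 <= INR (S n)) by (apply (le_INR 1); lia).
  rewrite (S_INR (S n)); set (x := INR (S n)) in *.
  rewrite Rabs_pos_eq by (apply Rlt_le, Rinv_0_lt_compat, pow_lt; lra).
  apply Rle_trans with (/ x ^ 2).
  + apply Rinv_le_contravar; [apply pow_lt; lra | apply Rle_pow; [exact Hn | lia]].
  + replace (2 * (/ x - / (x + 1))) with (2 / (x * (x + 1))) by (field; lra).
    apply Rle_div_r; [nra |].
    rewrite Rmult_comm; apply Rle_div_l; [nra |]. nra.
- exists (2 * 1).
  apply (is_series_scal_l (K := R_AbsRing) (V := R_NormedModule) 2
    (fun n => / INR (S n) - / INR (S (S n))) 1).
  change (is_lim_seq (sum_n (fun n => / INR (S n) - / INR (S (S n)))) 1).
  apply (is_lim_seq_ext (fun n => 1 - / INR (S (S n)))).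
  + intros n; induction n as [|n IH].
    * rewrite sum_O; simpl INR; rewrite Rinv_1; reflexivity.
    * rewrite sum_Sn, <- IH; change (@plus R_AbelianMonoid) with Rplus; eq_R; ring.
  + replace (Finite 1) with (Finite (1 - 0)) by (f_equal; ring).
    apply is_lim_seq_minus'; [apply is_lim_seq_const |].
    apply (is_lim_seq_inv _ p_infty); [| easy].
    apply -> (is_lim_seq_incr_1 (fun n => INR (S n))).
    apply -> is_lim_seq_incr_1; apply is_lim_seq_INR.
Qed.

(** * Complex functions of a real variable *)

Definition is_Cderive (F : R -> C) (x : R) (l : C) : Prop :=
  is_derive (fun t => Re (F t)) x (Re l) /\ is_derive (fun t => Im (F t)) x (Im l).

Lemma is_Cderive_ext (F G : R -> C) (x : R) (l : C) :
  (forall t, F t = G t) -> is_Cderive F x l -> is_Cderive G x l.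
Proof.
intros E [H1 H2]; split;
  [apply (is_derive_ext (fun t => Re (F t))) | apply (is_derive_ext (fun t => Im (F t)))];
  try assumption; intros; rewrite E; reflexivity.
Qed.

Lemma is_derive_const_R (c x : R) : is_derive (fun _ => c) x 0.
Proof. exact (is_derive_const (K := R_AbsRing) (V := R_NormedModule) c x). Qed.

Lemma is_Cderive_RtoC (f : R -> R) (x l : R) :
  is_derive f x l -> is_Cderive (fun t => RtoC (f t)) x (RtoC l).
Proof. intros H; split; [exact H | exact (is_derive_const_R 0 x)]. Qed.

Lemma is_Cderive_const (c : C) (x : R) : is_Cderive (fun _ => c) x (RtoC 0).
Proof. split; apply is_derive_const_R. Qed.

Lemma is_Cderive_plus (F G : R -> C) (x : R) (l m : C) :
  is_Cderive F x l -> is_Cderive G x m ->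
  is_Cderive (fun t => (F t + G t)%C) x (l + m)%C.
Proof.
intros [H1 H2] [H3 H4]; split; simpl.
- exact (is_derive_plus (V := R_NormedModule) _ _ _ _ _ H1 H3).
- exact (is_derive_plus (V := R_NormedModule) _ _ _ _ _ H2 H4).
Qed.

Lemma is_Cderive_mult (F G : R -> C) (x : R) (l m : C) :
  is_Cderive F x l -> is_Cderive G x m ->
  is_Cderive (fun t => (F t * G t)%C) x (l * G x + F x * m)%C.
Proof.
intros [H1 H2] [H3 H4]; split; simpl.
- replace (_ + _) with (minus (Re l * Re (G x) + Re (F x) * Re m)
      (Im l * Im (G x) + Im (F x) * Im m))
    by (unfold minus, plus, opp, Re, Im; simpl; ring).
  apply (is_derive_minus (V := R_NormedModule)
    (fun t => Re (F t) * Re (G t)) (fun t => Im (F t) * Im (G t)));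
    apply is_derive_mult_R; assumption.
- replace (_ + _) with (plus (Re l * Im (G x) + Re (F x) * Im m)
      (Im l * Re (G x) + Im (F x) * Re m))
    by (unfold plus, Re, Im; simpl; ring).
  apply (is_derive_plus (V := R_NormedModule)
    (fun t => Re (F t) * Im (G t)) (fun t => Im (F t) * Re (G t)));
    apply is_derive_mult_R; assumption.
Qed.

Lemma is_Cderive_scal (c : C) (F : R -> C) (x : R) (l : C) :
  is_Cderive F x l -> is_Cderive (fun t => (c * F t)%C) x (c * l)%C.
Proof.
intros H; replace (c * l)%C with (RtoC 0 * F x + c * l)%C by ring.
apply (is_Cderive_mult (fun _ => c)); [apply is_Cderive_const | exact H].
Qed.

Lemma is_Cderive_minus (F G : R -> C) (x : R) (l m : C) :
  is_Cderive F x l -> is_Cderive G x m ->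
  is_Cderive (fun t => (F t - G t)%C) x (l - m)%C.
Proof.
intros H1 H2; apply is_Cderive_plus; [exact H1 |].
apply (is_Cderive_ext (fun t => (RtoC (-1) * G t)%C)).
- intros; apply injective_projections; simpl; ring.
- replace (- m)%C with (RtoC (-1) * m)%C by (apply injective_projections; simpl; ring).
  apply is_Cderive_scal; exact H2.
Qed.

Lemma is_Cderive_Cexp (F : R -> C) (x : R) (l : C) :
  is_Cderive F x l -> is_Cderive (fun t => Cexp (F t)) x (l * Cexp (F x))%C.
Proof.
intros [H1 H2]; unfold Cexp; split; simpl.
- replace (_ - _) with
    ((Re l * exp (Re (F x))) * cos (Im (F x))
     + exp (Re (F x)) * (Im l * (- sin (Im (F x)))))
    by (unfold Re, Im; ring).
  apply (is_derive_mult_R (fun t => exp (Re (F t))) (fun t => cos (Im (F t)))).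
  + exact (is_derive_comp exp (fun t => Re (F t)) x _ _ (is_derive_exp _) H1).
  + exact (is_derive_comp cos (fun t => Im (F t)) x _ _ (is_derive_cos _) H2).
- replace (_ + _) with
    ((Re l * exp (Re (F x))) * sin (Im (F x))
     + exp (Re (F x)) * (Im l * cos (Im (F x))))
    by (unfold Re, Im; ring).
  apply (is_derive_mult_R (fun t => exp (Re (F t))) (fun t => sin (Im (F t)))).
  + exact (is_derive_comp exp (fun t => Re (F t)) x _ _ (is_derive_exp _) H1).
  + exact (is_derive_comp sin (fun t => Im (F t)) x _ _ (is_derive_sin _) H2).
Qed.

Lemma Cmod_le_Re_Im (z : C) : Cmod z <= Rabs (Re z) + Rabs (Im z).
Proof.
destruct z as [p q].
replace (p, q) with (RtoC p + Ci * RtoC q)%C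
  by (apply injective_projections; simpl; ring).
apply Rle_trans with (1 := Cmod_triangle _ _).
rewrite Cmod_mult, Cmod_Ci, !Cmod_R; simpl.
rewrite Rmult_1_l; apply Req_le; f_equal; f_equal; ring.
Qed.

Lemma im_le_Cmod (z : C) : Rabs (Im z) <= Cmod z.
Proof. apply Rle_trans with (2 := Rmax_Cmod z), Rmax_r. Qed.

(** The mean value theorem fails for complex values, so it is applied to the real and imaginary
    parts separately. This costs the factor 2. *)
Lemma is_Cderive_bound (F F' : R -> C) (b K : R) :
  0 <= b -> (forall x, 0 <= x <= b -> is_Cderive F x (F' x)) ->
  (forall x, 0 <= x <= b -> Cmod (F' x) <= K) ->
  Cmod (F b - F 0)%C <= 2 * K * b.
Proof.
intros Hb HF HK.
assert (Hc : forall f f' : R -> R, (forall x, 0 <= x <= b -> is_derive f x (f' x)) ->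
          (forall x, 0 <= x <= b -> Rabs (f' x) <= K) ->
          Rabs (f b - f 0) <= K * b).
{ intros f f' Hf Hf'.
  destruct (MVT_gen f 0 b f') as [c [Hc1 Hc2]].
  - rewrite Rmin_left, Rmax_right by exact Hb; intros; apply Hf; lra.
  - rewrite Rmin_left, Rmax_right by exact Hb; intros x Hx.
    apply continuity_pt_filterlim, (ex_derive_continuous (V := R_NormedModule)).
    exists (f' x); apply Hf; exact Hx.
  - rewrite Rmin_left, Rmax_right in Hc1 by exact Hb.
    rewrite Hc2, Rabs_mult, (Rabs_pos_eq (b - 0)) by lra.
    rewrite Rminus_0_r; apply Rmult_le_compat_r; [exact Hb | apply Hf'; exact Hc1]. }
apply Rle_trans with (1 := Cmod_le_Re_Im _).
assert (H1 : Rabs (Re (F b - F 0)%C) <= K * b).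
{ apply (Hc (fun t => Re (F t)) (fun t => Re (F' t))).
  - intros x Hx; apply HF; exact Hx.
  - intros x Hx; apply Rle_trans with (2 := HK x Hx), re_le_Cmod. }
assert (H2 : Rabs (Im (F b - F 0)%C) <= K * b).
{ apply (Hc (fun t => Im (F t)) (fun t => Im (F' t))).
  - intros x Hx; apply HF; exact Hx.
  - intros x Hx; apply Rle_trans with (2 := HK x Hx), im_le_Cmod. }
lra.
Qed.

Lemma is_Cderive_at_right (F : R -> C) (l : C) (eps : R) :
  is_Cderive F 0 l -> 0 < eps ->
  at_right 0 (fun t => Cmod ((F t - F 0) / RtoC t - l)%C <= eps).
Proof.
intros [H1 H2] He.
apply is_derive_Reals in H1; apply is_derive_Reals in H2.
destruct (H1 (eps / 2)) as [d1 Hd1]; [lra |].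
destruct (H2 (eps / 2)) as [d2 Hd2]; [lra |].
exists (mkposreal (Rmin d1 d2) (Rmin_stable_in_posreal d1 d2)).
intros t Ht Ht0.
assert (Htd : Rabs t < Rmin d1 d2).
{ revert Ht; unfold ball; simpl; unfold AbsRing_ball, abs, minus, plus, opp; simpl.
  rewrite Ropp_0, Rplus_0_r; trivial. }
pose proof (Rmin_l d1 d2); pose proof (Rmin_r d1 d2).
specialize (Hd1 t); specialize (Hd2 t); rewrite Rplus_0_l in Hd1, Hd2.
assert (A1 := Hd1 ltac:(lra) ltac:(lra)); assert (A2 := Hd2 ltac:(lra) ltac:(lra)).
apply Rle_trans with (1 := Cmod_le_Re_Im _).
replace (Re ((F t - F 0) / RtoC t - l)%C)
  with ((Re (F t) - Re (F 0)) / t - Re l) by (unfold Re, Im; simpl; field; lra).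
replace (Im ((F t - F 0) / RtoC t - l)%C)
  with ((Im (F t) - Im (F 0)) / t - Im l) by (unfold Re, Im; simpl; field; lra).
lra.
Qed.

(** * Exponential, logarithm and inverse powers on the right half-plane *)

Lemma Re_pos_neq_0 (z : C) : 0 < Re z -> z <> RtoC 0.
Proof. intros H E; rewrite E in H; simpl in H; lra. Qed.

Lemma Cmod_pos (z : C) : 0 < Re z -> 0 < Cmod z.
Proof. intros H; apply Cmod_gt_0, Re_pos_neq_0, H. Qed.

Lemma Cmod_shift_sqr (z : C) (x : R) :
  0 < Re z -> 0 <= x -> Cmod z ^ 2 + x ^ 2 <= Cmod (z + RtoC x)%C ^ 2.
Proof.
intros Hz Hx; rewrite !Cmod2_alt; destruct z as [p q]; simpl in *; nra.
Qed.

Lemma Cmod_shift_ge (z : C) (x : R) :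
  0 < Re z -> 0 <= x -> Cmod z <= Cmod (z + RtoC x)%C /\ x <= Cmod (z + RtoC x)%C.
Proof.
intros Hz Hx; pose proof (Cmod_shift_sqr z x Hz Hx).
pose proof (Cmod_ge_0 z); pose proof (Cmod_ge_0 (z + RtoC x)%C).
pose proof (pow2_ge_0 x); pose proof (pow2_ge_0 (Cmod z)).
split; apply Rsqr_incr_0_var; unfold Rsqr; lra.
Qed.

Lemma Re_shift_pos (z : C) (x : R) : 0 < Re z -> 0 <= x -> 0 < Re (z + RtoC x)%C.
Proof. intros; rewrite re_plus, re_RtoC; lra. Qed.

(** The case distinction in [Carg] hides differentiability across the real axis; the arctangent
    form, valid in the right half-plane, shows it. *)
Lemma Carg_atan (z : C) : 0 < Re z -> Carg z = atan (Im z / Re z).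
Proof.
intros Hz; unfold Carg.
pose proof (Cmod_pos z Hz) as Hm; pose proof (Cmod2_alt z) as E.
set (p := Re z) in *; set (q := Im z) in *; set (m := Cmod z) in *.
assert (Hpm : 0 < p / m) by (apply Rdiv_lt_0_compat; assumption).
assert (E1 : sqrt (1 - (p / m)²) / (p / m) = Rabs q / p).
{ replace (1 - (p / m)²) with ((Rabs q / m)²).
  - rewrite sqrt_Rsqr; [field; lra |].
    apply Rdiv_le_0_compat; [apply Rabs_pos | exact Hm].
  - rewrite !Rsqr_div', <- Rsqr_abs; unfold Rsqr.
    replace (q * q) with (m * m - p * p) by nra; field; lra. }
rewrite acos_atan, E1 by exact Hpm.
destruct (Rle_dec 0 q) as [Hq|Hq].
- rewrite Rabs_pos_eq by exact Hq; reflexivity.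
- rewrite Rabs_left, <- atan_opp by lra; f_equal; field; lra.
Qed.

Lemma Cexp_plus (z w : C) : Cexp (z + w)%C = (Cexp z * Cexp w)%C.
Proof.
unfold Cexp; rewrite re_plus; change (Im (z + w)%C) with (Im z + Im w).
rewrite exp_plus, cos_plus, sin_plus; apply injective_projections; simpl; ring.
Qed.

Lemma Cexp_0 : Cexp (RtoC 0) = RtoC 1.
Proof.
unfold Cexp; simpl; rewrite exp_0, cos_0, sin_0; apply injective_projections; simpl; ring.
Qed.

Lemma Cmod_Cexp (z : C) : Cmod (Cexp z) = exp (Re z).
Proof.
pose proof (exp_pos (Re z)).
unfold Cexp, Cmod; simpl.
replace (_ + _) with ((exp (Re z))²).
- apply sqrt_Rsqr; lra.
- pose proof (sin2_cos2 (Im z)) as E; unfold Rsqr in *.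
  transitivity (exp (Re z) * exp (Re z) * (sin (Im z) * sin (Im z) + cos (Im z) * cos (Im z)));
    [rewrite E |]; ring.
Qed.

Lemma Cexp_Cln (z : C) : 0 < Re z -> Cexp (Cln z) = z.
Proof.
intros Hz; unfold Cexp, Cln; simpl.
pose proof (Cmod_pos z Hz) as Hm; pose proof (Cmod2_alt z) as E.
rewrite exp_ln, Carg_atan, cos_atan, sin_atan by assumption.
assert (Es : sqrt (1 + (Im z / Re z)²) = Cmod z / Re z).
{ replace (1 + (Im z / Re z)²) with ((Cmod z / Re z)²).
  - apply sqrt_Rsqr, Rdiv_le_0_compat; lra.
  - rewrite !Rsqr_div'; unfold Rsqr.
    replace (Cmod z * Cmod z) with (Re z ^ 2 + Im z ^ 2) by nra; field; lra. }
rewrite Es; destruct z as [p q]; simpl in *.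
apply injective_projections; simpl; field; lra.
Qed.

Lemma is_Cderive_Cln_shift (z : C) (x : R) :
  0 < Re z + x -> is_Cderive (fun t => Cln (z + RtoC t)%C) x (/ (z + RtoC x))%C.
Proof.
intros Hx; destruct z as [p q]; simpl in Hx.
assert (Hpos : 0 < (p + x) ^ 2 + q ^ 2) by nra.
split.
- apply (is_derive_ext (fun t => ln (sqrt ((p + t) ^ 2 + q ^ 2)))).
  { intros t; unfold Cln, Cmod; simpl; rewrite Rplus_0_r; reflexivity. }
  assert (Hs : 0 < sqrt ((p + x) ^ 2 + q ^ 2)) by (apply sqrt_lt_R0; exact Hpos).
  assert (Hss := sqrt_sqrt _ (Rlt_le _ _ Hpos)).
  simpl in *; rewrite Rplus_0_r.
  auto_derive; [repeat split; assumption |].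
  set (s := sqrt _) in *; field_simplify_eq; [nra | split; lra].
(* The arctangent form requires a positive real part, so the functions are only compared within
   distance [p + x] of [x]. *)
- apply (is_derive_ext_loc (fun t => atan (q / (p + t)))).
  { exists (mkposreal _ Hx); intros t Ht.
    assert (H : Rabs (t - x) < p + x) by exact Ht.
    apply Rabs_lt_between in H.
    change (Im (Cln ((p, q) + RtoC t)%C)) with (Carg ((p, q) + RtoC t)%C).
    rewrite Carg_atan by (simpl; lra).
    simpl; rewrite Rplus_0_r; reflexivity. }
  simpl; rewrite Rplus_0_r.
  auto_derive; [lra |].
  field; split; [lra |]. simpl; nra.
Qed.

Lemma is_Cderive_inv_shift (z : C) (x : R) :
  (z + RtoC x)%C <> RtoC 0 ->
  is_Cderive (fun t => / (z + RtoC t))%C x (- (/ (z + RtoC x) * / (z + RtoC x)))%C.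
Proof.
intros Hx; destruct z as [p q].
assert (Hpos : 0 < (p + x) ^ 2 + q ^ 2).
{ apply Cmod_gt_0 in Hx; pose proof (Cmod2_alt ((p, q) + RtoC x)%C) as E.
  pose proof (pow_lt _ 2 Hx) as H; rewrite E in H; simpl in *.
  rewrite Rplus_0_r in H; exact H. }
split.
- replace (Re (- (/ ((p, q) + RtoC x) * / ((p, q) + RtoC x)))%C)
    with ((q ^ 2 - (p + x) ^ 2) / ((p + x) ^ 2 + q ^ 2) ^ 2)
    by (simpl; rewrite !Rplus_0_r; field; simpl in Hpos; lra).
  apply (is_derive_ext (fun t => (p + t) / ((p + t) ^ 2 + q ^ 2))).
  { intros t; simpl; rewrite !Rplus_0_r; reflexivity. }
  auto_derive; [simpl in Hpos; lra | field; lra].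
- replace (Im (- (/ ((p, q) + RtoC x) * / ((p, q) + RtoC x)))%C)
    with (2 * (p + x) * q / ((p + x) ^ 2 + q ^ 2) ^ 2)
    by (simpl; rewrite !Rplus_0_r; field; simpl in Hpos; lra).
  apply (is_derive_ext (fun t => - q / ((p + t) ^ 2 + q ^ 2))).
  { intros t; simpl; rewrite !Rplus_0_r; reflexivity. }
  auto_derive; [simpl in Hpos; lra | field; lra].
Qed.

Lemma is_Cderive_inv_pow_shift (z : C) (n : nat) (x : R) :
  (z + RtoC x)%C <> RtoC 0 ->
  is_Cderive (fun t => (/ (z + RtoC t)) ^ n)%C x
    (- RtoC (INR n) * (/ (z + RtoC x)) ^ (S n))%C.
Proof.
intros Hx; induction n as [|n IH].
- replace (- RtoC (INR 0) * (/ (z + RtoC x)) ^ 1)%C with (RtoC 0)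
    by (simpl INR; ring).
  exact (is_Cderive_const (RtoC 1) x).
- apply (is_Cderive_ext (fun t => / (z + RtoC t) * (/ (z + RtoC t)) ^ n)%C);
    [intros t; rewrite Cpow_S; reflexivity |].
  replace (- RtoC (INR (S n)) * (/ (z + RtoC x)) ^ S (S n))%C
    with (- (/ (z + RtoC x) * / (z + RtoC x)) * (/ (z + RtoC x)) ^ n
          + / (z + RtoC x) * (- RtoC (INR n) * (/ (z + RtoC x)) ^ S n))%C.
  + apply (is_Cderive_mult (fun t => / (z + RtoC t))%C (fun t => (/ (z + RtoC t)) ^ n)%C).
    * apply is_Cderive_inv_shift; exact Hx.
    * exact IH.
  + generalize (/ (z + RtoC x))%C; intros w.
    rewrite S_INR, RtoC_plus, !Cpow_S; ring.
Qed.

(** * Euler-Maclaurin summation *)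

Fixpoint csum (f : nat -> C) (n : nat) : C :=
  match n with O => RtoC 0 | S n' => (csum f n' + f n')%C end.

Lemma sum_n_csum (f : nat -> C) (n : nat) :
  sum_n (G := C_AbelianMonoid) f n = csum f (S n).
Proof.
induction n as [|n IH].
- rewrite sum_O; simpl; ring.
- rewrite sum_Sn, IH; reflexivity.
Qed.

Lemma Cmod_minus_triangle (x y z : C) : Cmod (x - z)%C <= Cmod (x - y)%C + Cmod (y - z)%C.
Proof. replace (x - z)%C with ((x - y) + (y - z))%C by ring; apply Cmod_triangle. Qed.

Lemma RtoC_INR_S (n : nat) : RtoC (INR (S n)) = (RtoC (INR n) + RtoC 1)%C.
Proof. rewrite S_INR; apply RtoC_plus. Qed.

(* Euler-Maclaurin on one cell: the sum is chosen so that its derivative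
   collapses to the last remainder term. *)
Fixpoint em (a : C) (L : nat) (x : R) : C :=
  match L with
  | O => Cln (a + RtoC x)%C
  | S L' => (em a L' x
             - RtoC (INR (fact L') * bern L x) * (/ (a + RtoC x)) ^ L)%C
  end.

Lemma is_Cderive_em (a : C) (L : nat) (x : R) :
  0 < Re a -> 0 <= x ->
  is_Cderive (em a L) x
    (RtoC (INR (fact L) * bern L x) * (/ (a + RtoC x)) ^ (S L))%C.
Proof.
intros Ha Hx.
assert (Hz : (a + RtoC x)%C <> RtoC 0) by (apply Re_pos_neq_0, Re_shift_pos; assumption).
induction L as [|L IH].
- replace (_ * _)%C with (/ (a + RtoC x))%C
    by (simpl bern; simpl fact; rewrite Cpow_1_r, Rmult_1_r; simpl INR; ring).
  apply is_Cderive_Cln_shift; lra.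
- pose proof (is_Cderive_mult (fun t => RtoC (INR (fact L) * bern (S L) t))
    (fun t => (/ (a + RtoC t)) ^ S L)%C x (RtoC (INR (fact L) * bern L x))
    (- RtoC (INR (S L)) * (/ (a + RtoC x)) ^ S (S L))%C) as H.
  assert (H' := is_Cderive_minus _ _ _ _ _ IH (H ltac:(
     apply is_Cderive_RtoC;
     exact (is_derive_scal _ _ _ _ (is_derive_bern L x)))
     (is_Cderive_inv_pow_shift a (S L) x Hz))).
  replace (RtoC (INR (fact (S L)) * bern (S L) x) * (/ (a + RtoC x)) ^ S (S L))%C
    with (RtoC (INR (fact L) * bern L x) * (/ (a + RtoC x)) ^ S L -
       (RtoC (INR (fact L) * bern L x) * (/ (a + RtoC x)) ^ S L +
        RtoC (INR (fact L) * bern (S L) x) *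
        (- RtoC (INR (S L)) * (/ (a + RtoC x)) ^ S (S L))))%C; [exact H' |].
  rewrite fact_simpl, mult_INR, !RtoC_mult; ring.
Qed.

(** Consecutive cells match at their common end except for [bern 1], whose increment 1 produces the
    term [/ (a + RtoC 1)]. *)
Lemma em_1 (a : C) (L : nat) :
  em a (S L) 1 = (em (a + RtoC 1) (S L) 0 - / (a + RtoC 1))%C.
Proof.
induction L as [|L IH].
- change (em a 1 1) with
    (Cln (a + RtoC 1) - RtoC (INR (fact 0) * bern 1 1) * (/ (a + RtoC 1)) ^ 1)%C.
  change (em (a + RtoC 1) 1 0) with
    (Cln (a + RtoC 1 + RtoC 0)
     - RtoC (INR (fact 0) * bern 1 0) * (/ (a + RtoC 1 + RtoC 0)) ^ 1)%C.
  rewrite !bern_1, !Cpow_1_r, Cplus_0_r; simpl fact; simpl INR.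
  replace (1 * (1 - / 2)) with (1 / 2) by field.
  replace (1 * (0 - / 2)) with (1 / 2 - 1) by field.
  rewrite RtoC_minus; ring.
- change (em a (S (S L)) 1) with (em a (S L) 1
    - RtoC (INR (fact (S L)) * bern (S (S L)) 1) * (/ (a + RtoC 1)) ^ S (S L))%C.
  change (em (a + RtoC 1) (S (S L)) 0) with (em (a + RtoC 1) (S L) 0
    - RtoC (INR (fact (S L)) * bern (S (S L)) 0) * (/ (a + RtoC 1 + RtoC 0)) ^ S (S L))%C.
  rewrite IH, bern_1_minus_0, (Cplus_0_r (a + RtoC 1)); ring.
Qed.

(* Approximates [- gamma_0(a)]; the term [- / a] makes it telescope with
   increments [1/(a+n)]. *)
Definition em_approx (L : nat) (a : C) : C := (em a (S L) 0 - / a)%C.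

(** Moves the base point far to the right, where [em_approx] is close to the logarithm. The second
    sum is the accumulated Euler-Maclaurin remainder. *)
Lemma em_approx_shift (L : nat) (a : C) (M : nat) :
  em_approx L (a + RtoC (INR M)) =
  (em_approx L a + csum (fun n => / (a + RtoC (INR n))) M
   + csum (fun n => em (a + RtoC (INR n)) (S L) 1 - em (a + RtoC (INR n)) (S L) 0) M)%C.
Proof.
induction M as [|M IH].
- simpl csum; simpl INR; rewrite Cplus_0_r; ring.
- rewrite RtoC_INR_S, Cplus_assoc.
  set (b := (a + RtoC (INR M))%C) in *.
  change (csum (fun n => / (a + RtoC (INR n)))%C (S M))
    with (csum (fun n => / (a + RtoC (INR n)))%C M + / b)%C.
  change (csum (fun n => em (a + RtoC (INR n)) (S L) 1 - em (a + RtoC (INR n)) (S L) 0)%C (S M))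
    with (csum (fun n => em (a + RtoC (INR n)) (S L) 1 - em (a + RtoC (INR n)) (S L) 0)%C M
          + (em b (S L) 1 - em b (S L) 0))%C.
  unfold em_approx in *; rewrite em_1.
  transitivity ((em b (S L) 0 - / b) + / b
     + (em (b + RtoC 1) (S L) 0 - / (b + RtoC 1) - em b (S L) 0))%C; [ring |].
  rewrite IH; ring.
Qed.

Lemma em_cell_bound (L : nat) :
  exists K, 0 <= K /\ forall a, 0 < Re a ->
    Cmod (em a L 1 - em a L 0)%C <= K * (/ Cmod a) ^ (S L).
Proof.
destruct (bern_bounded L) as [B HB].
assert (HB0 : 0 <= B).
{ apply Rle_trans with (Rabs (bern L 0)); [apply Rabs_pos | apply HB; lra]. }
pose proof (INR_fact_lt_0 L) as Hf.
exists (2 * (INR (fact L) * B)); split; [nra |].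
intros a Ha.
pose proof (is_Cderive_bound (em a L)
  (fun x => RtoC (INR (fact L) * bern L x) * (/ (a + RtoC x)) ^ (S L))%C
  1 (INR (fact L) * B * (/ Cmod a) ^ S L)) as H.
replace (2 * (INR (fact L) * B) * (/ Cmod a) ^ S L)
  with (2 * (INR (fact L) * B * (/ Cmod a) ^ S L) * 1) by ring.
apply H; [lra | intros; apply is_Cderive_em; [exact Ha | lra] |].
intros x Hx; cbv beta.
assert (Hz : (a + RtoC x)%C <> RtoC 0)
  by (apply Re_pos_neq_0, Re_shift_pos; [exact Ha | lra]).
rewrite Cmod_mult, Cmod_R, Cmod_pow, Cmod_inv, Rabs_mult, (Rabs_pos_eq (INR _))
  by (assumption || lra).
destruct (Cmod_shift_ge a x Ha) as [H1 _]; [lra |].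
pose proof (Cmod_pos a Ha) as H0.
assert (H2 : 0 < / Cmod (a + RtoC x)%C) by (apply Rinv_0_lt_compat; lra).
apply Rmult_le_compat.
- apply Rmult_le_pos; [lra | apply Rabs_pos].
- apply pow_le; lra.
- apply Rmult_le_compat_l; [lra | apply HB; exact Hx].
- apply pow_incr; split; [lra | apply Rinv_le_contravar; assumption].
Qed.

Lemma em_approx_minus_Cln (L : nat) :
  exists K, 0 <= K /\ forall a, 0 < Re a -> 1 <= Cmod a ->
    Cmod (em_approx L a - Cln a)%C <= K / Cmod a.
Proof.
assert (H : exists K, 0 <= K /\ forall a, 0 < Re a -> 1 <= Cmod a ->
    Cmod (em a (S L) 0 - Cln a)%C <= K / Cmod a).
{ generalize (S L) as j; induction j as [|j [K [HK IH]]].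
  - exists 0; split; [lra |]; intros a Ha _; simpl.
    rewrite Cplus_0_r; replace (Cln a - Cln a)%C with (RtoC 0) by ring.
    rewrite Cmod_0; unfold Rdiv; lra.
  - set (c := Rabs (INR (fact j) * bern (S j) 0)).
    exists (K + c); split; [unfold c; pose proof (Rabs_pos (INR (fact j) * bern (S j) 0)); lra |].
    intros a Ha Ha1.
    apply Rle_trans with (1 := Cmod_minus_triangle _ (em a j 0) _).
    replace ((K + c) / Cmod a) with (c / Cmod a + K / Cmod a) by (field; lra).
    apply Rplus_le_compat; [| apply IH; assumption].
    change (em a (S j) 0) with
      (em a j 0 - RtoC (INR (fact j) * bern (S j) 0) * (/ (a + RtoC 0)) ^ S j)%C.
    rewrite Cplus_0_r.
    replace (em a j 0 - RtoC (INR (fact j) * bern (S j) 0) * (/ a) ^ S j - em a j 0)%C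
      with (- (RtoC (INR (fact j) * bern (S j) 0) * (/ a) ^ S j))%C by ring.
    rewrite Cmod_opp, Cmod_mult, Cmod_R, Cmod_pow, Cmod_inv by (apply Re_pos_neq_0, Ha).
    fold c; unfold Rdiv; apply Rmult_le_compat_l; [apply Rabs_pos |].
    rewrite <- (Rmult_1_r (/ Cmod a)) at 2; simpl.
    assert (0 < / Cmod a) by (apply Rinv_0_lt_compat; lra).
    apply Rmult_le_compat_l; [lra |].
    rewrite <- (pow1 j); apply pow_incr; split; [lra |].
    rewrite <- Rinv_1; apply Rinv_le_contravar; lra. }
destruct H as [K [HK H]].
exists (K + 1); split; [lra |]; intros a Ha Ha1.
unfold em_approx.
replace (em a (S L) 0 - / a - Cln a)%C with ((em a (S L) 0 - Cln a) + - / a)%C by ring.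
apply Rle_trans with (1 := Cmod_triangle _ _).
rewrite Cmod_opp, Cmod_inv by (apply Re_pos_neq_0, Ha).
replace ((K + 1) / Cmod a) with (K / Cmod a + / Cmod a) by (field; lra).
apply Rplus_le_compat_r, H; assumption.
Qed.

(** With [r = |a|], a cell contributes [L + 2] powers of [1/|a+n|]. [L] of them are bounded by
    powers of [1/r]. The other two give [1/|a+n|^2 <= 2/(r+n)^2 <= 2/((r+n-1)(r+n))], which
    telescopes to [2/(r-1)]. *)
Lemma csum_em_bound (L : nat) :
  exists K, 0 <= K /\ forall a M, 0 < Re a -> 1 < Cmod a ->
    Cmod (csum (fun n => em (a + RtoC (INR n)) (S L) 1
                         - em (a + RtoC (INR n)) (S L) 0)%C M)
    <= K * (/ Cmod a) ^ L / (Cmod a - 1).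
Proof.
destruct (em_cell_bound (S L)) as [K [HK Hcell]].
exists (2 * K); split; [lra |]; intros a M Ha Ha1.
set (r := Cmod a) in *.
assert (Hp : 0 <= (/ r) ^ L) by (apply pow_le, Rlt_le, Rinv_0_lt_compat; lra).
apply Rle_trans with (2 * K * (/ r) ^ L * (/ (r - 1) - / (r - 1 + INR M))).
- induction M as [|M IH].
  + simpl; rewrite Cmod_0, Rplus_0_r; lra.
  + apply Rle_trans with (1 := Cmod_triangle _ _).
    apply Rle_trans with (1 := Rplus_le_compat_r _ _ _ IH).
    pose proof (pos_INR M) as HM.
    set (b := (a + RtoC (INR M))%C).
    assert (Hb : 0 < Re b) by (apply Re_shift_pos; assumption).
    assert (Hbr : (r + INR M) ^ 2 <= 2 * Cmod b ^ 2).
    { pose proof (Cmod_shift_sqr a (INR M) Ha HM) as E; fold r b in E.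
      pose proof (pow2_ge_0 (r - INR M)); lra. }
    destruct (Cmod_shift_ge a (INR M) Ha HM) as [Hb1 _]; fold r b in Hb1.
    apply Rle_trans with (2 * K * (/ r) ^ L * (/ (r - 1) - / (r - 1 + INR M))
                          + K * ((/ r) ^ L * (2 / ((r - 1 + INR M) * (r + INR M))))).
    { apply Rplus_le_compat_l, Rle_trans with (1 := Hcell b Hb).
      apply Rmult_le_compat_l; [exact HK |].
      replace (S (S L)) with (L + 2)%nat by lia; rewrite pow_add.
      assert (0 < / Cmod b) by (apply Rinv_0_lt_compat; lra).
      apply Rmult_le_compat; [apply pow_le; lra | apply pow_le; lra | |].
      - apply pow_incr; split; [lra | apply Rinv_le_contravar; lra].
      - rewrite pow_inv; apply Rle_trans with (/ ((r + INR M) ^ 2 / 2)).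
        + apply Rinv_le_contravar; [| lra].
          assert (0 < (r + INR M) ^ 2) by (apply pow_lt; lra); lra.
        + replace (/ ((r + INR M) ^ 2 / 2)) with (2 / ((r + INR M) * (r + INR M)))
            by (field; lra).
          apply Rmult_le_compat_l; [lra |].
          apply Rinv_le_contravar; nra. }
    rewrite S_INR.
    apply Req_le; field; repeat split; lra.
- unfold Rdiv; apply Rmult_le_compat_l; [nra |].
  pose proof (pos_INR M).
  assert (0 < / (r - 1 + INR M)) by (apply Rinv_0_lt_compat; lra); lra.
Qed.

Lemma le_of_inv_nat (x y D : R) :
  (forall M, (0 < M)%nat -> x <= y + D / INR M) -> x <= y.
Proof.
intros H.
apply (is_lim_seq_le (fun _ => x) (fun M => y + D * / INR (S M)) x y).
- intros M; apply H; lia.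
- apply is_lim_seq_const.
- replace (Finite y) with (Finite (y + D * 0)) by (f_equal; ring).
  apply is_lim_seq_plus'; [apply is_lim_seq_const |].
  apply (is_lim_seq_scal_l _ D 0), (is_lim_seq_inv _ p_infty); [| easy].
  apply -> is_lim_seq_incr_1; apply is_lim_seq_INR.
Qed.

(** [M] is sent to infinity for fixed [a], so both [D] and the distance from [em_approx] to the
    logarithm disappear, and [K] depends on [L] alone. *)
Lemma em_approx_error (L : nat) :
  exists K, 0 <= K /\ forall (a g : C) (D : R), 0 < Re a -> 1 < Cmod a ->
    (forall M, (0 < M)%nat ->
       Cmod (g - csum (fun n => / (a + RtoC (INR n)))%C M
             + Cln (a + RtoC (INR M)))%C <= D / INR M) ->
    Cmod (g + em_approx L a)%C <= K * (/ Cmod a) ^ L / (Cmod a - 1).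
Proof.
destruct (csum_em_bound L) as [K [HK Hsum]].
destruct (em_approx_minus_Cln L) as [K' [HK' Hln]].
exists K; split; [exact HK |]; intros a g D Ha Ha1 Hg.
apply (le_of_inv_nat _ _ (D + K')); intros M HM.
assert (HM1 : 1 <= INR M) by (apply (le_INR 1); lia).
pose proof (em_approx_shift L a M) as E.
specialize (Hsum a M Ha Ha1); specialize (Hg M HM).
set (S1 := csum (fun n => / (a + RtoC (INR n)))%C M) in *.
set (S2 := csum _ M) in *.
destruct (Cmod_shift_ge a (INR M) Ha) as [H1 H2]; [lra |].
specialize (Hln (a + RtoC (INR M))%C (Re_shift_pos a (INR M) Ha ltac:(lra)) ltac:(lra)).
set (b := (a + RtoC (INR M))%C) in *.
replace (g + em_approx L a)%C
  with (- S2 + ((g - S1 + Cln b) + (em_approx L b - Cln b)))%C by (rewrite E; ring).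
apply Rle_trans with (1 := Cmod_triangle _ _); rewrite Cmod_opp.
apply Rplus_le_compat; [exact Hsum |].
apply Rle_trans with (1 := Cmod_triangle _ _).
replace ((D + K') / INR M) with (D / INR M + K' / INR M) by (field; lra).
apply Rplus_le_compat; [exact Hg |].
apply Rle_trans with (1 := Hln).
apply Rmult_le_compat_l; [exact HK' | apply Rinv_le_contravar; lra].
Qed.

(** * The zeroth Stieltjes constant as a limit *)

(* [z^(-t)]. *)
Definition zpow (z : C) (t : R) : C := Cexp (RtoC (- t) * Cln z)%C.

Lemma Cexp_opp_Cln (z : C) : 0 < Re z -> Cexp (- Cln z)%C = (/ z)%C.
Proof.
intros Hz; pose proof (Re_pos_neq_0 z Hz) as H0.
replace (Cexp (- Cln z)) with (Cexp (- Cln z) * (Cexp (Cln z) * / z))%C.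
- rewrite Cmult_assoc, <- Cexp_plus.
  replace (- Cln z + Cln z)%C with (RtoC 0) by ring; rewrite Cexp_0; ring.
- rewrite Cexp_Cln by exact Hz; field; exact H0.
Qed.

Lemma Cpower_zpow (z : C) (t : R) :
  0 < Re z -> Cpower z (- RtoC (1 + t))%C = (zpow z t * / z)%C.
Proof.
intros Hz; unfold Cpower, zpow; rewrite <- Cexp_opp_Cln, <- Cexp_plus by exact Hz.
f_equal; rewrite RtoC_plus, RtoC_opp; ring.
Qed.

Lemma Cmod_zpow (z : C) (t : R) : Cmod (zpow z t) = exp (- t * ln (Cmod z)).
Proof. unfold zpow; rewrite Cmod_Cexp, re_scal_l; reflexivity. Qed.

Lemma exp_le_compat (x y : R) : x <= y -> exp x <= exp y.
Proof. intros [H|H]; [left; apply exp_increasing, H | rewrite H; right; reflexivity]. Qed.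

Lemma Cmod_zpow_le_1 (z : C) (t : R) : 1 <= Cmod z -> 0 <= t -> Cmod (zpow z t) <= 1.
Proof.
intros Hz Ht; rewrite Cmod_zpow, <- exp_0.
assert (0 <= ln (Cmod z)) by (rewrite <- ln_1; apply ln_le; lra).
apply exp_le_compat; nra.
Qed.

Lemma is_Cderive_zpow_shift (z : C) (t x : R) :
  0 < Re z + x ->
  is_Cderive (fun u => zpow (z + RtoC u) t) x
    (RtoC (- t) * / (z + RtoC x) * zpow (z + RtoC x) t)%C.
Proof.
intros Hx.
apply (is_Cderive_Cexp (fun u => RtoC (- t) * Cln (z + RtoC u))%C).
apply is_Cderive_scal, is_Cderive_Cln_shift; exact Hx.
Qed.

(** The subtracted difference is the integral of [(z+x)^(-1-t)] over the unit cell, so this is the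
    error of the left endpoint rule. The bound must be uniform in [t], which later tends to 0. In
    the constant 8, two factors 2 come from [is_Cderive_bound] and one from [1 + t <= 2]. *)
Lemma zpow_cell_bound (z : C) (t : R) :
  0 < Re z -> 1 <= Cmod z -> 0 < t <= 1 ->
  Cmod (zpow z t * / z - (zpow z t / RtoC t - zpow (z + RtoC 1) t / RtoC t))%C
  <= 8 / Cmod z ^ 2.
Proof.
intros Hz Hm Ht.
assert (Ht0 : RtoC t <> RtoC 0) by (intros E; apply RtoC_inj in E; lra).
set (G := fun x => (zpow (z + RtoC x) t * / (z + RtoC x))%C).
assert (Hinv : 0 < / Cmod z) by (apply Rinv_0_lt_compat; lra).
assert (HG : forall x, 0 <= x <= 1 -> Cmod (G x - G 0)%C <= 4 / Cmod z ^ 2).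
{ intros x Hx.
  apply Rle_trans with (2 * (2 / Cmod z ^ 2) * x).
  2: { replace (4 / Cmod z ^ 2) with (2 * (2 / Cmod z ^ 2) * 1) by (field; lra).
       apply Rmult_le_compat_l; [| lra].
       apply Rmult_le_pos; [lra |].
       apply Rlt_le, Rdiv_lt_0_compat; [lra | apply pow_lt; lra]. }
  apply (is_Cderive_bound G (fun y =>
    RtoC (- (1 + t)) * (zpow (z + RtoC y) t * (/ (z + RtoC y) * / (z + RtoC y))))%C);
    [lra | |].
  - intros y Hy.
    assert (Hy' : 0 < Re (z + RtoC y)%C) by (apply Re_shift_pos; lra).
    replace (RtoC (- (1 + t)) * (zpow (z + RtoC y) t * (/ (z + RtoC y) * / (z + RtoC y))))%C
      with ((RtoC (- t) * / (z + RtoC y) * zpow (z + RtoC y) t) * / (z + RtoC y)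
            + zpow (z + RtoC y) t * (- (/ (z + RtoC y) * / (z + RtoC y))))%C
      by (rewrite !RtoC_opp, RtoC_plus; ring).
    apply (is_Cderive_mult (fun u => zpow (z + RtoC u) t) (fun u => / (z + RtoC u))%C).
    + apply is_Cderive_zpow_shift; lra.
    + apply is_Cderive_inv_shift, Re_pos_neq_0, Hy'.
  - intros y Hy.
    assert (Hy' : 0 < Re (z + RtoC y)%C) by (apply Re_shift_pos; lra).
    destruct (Cmod_shift_ge z y Hz) as [H1 _]; [lra |].
    rewrite !Cmod_mult, Cmod_R, Cmod_inv, Rabs_Ropp, Rabs_pos_eq
      by (lra || apply Re_pos_neq_0, Hy').
    assert (H2 : Cmod (zpow (z + RtoC y) t) <= 1) by (apply Cmod_zpow_le_1; lra).
    assert (H3 : / Cmod (z + RtoC y)%C <= / Cmod z) by (apply Rinv_le_contravar; lra).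
    assert (H4 : 0 < / Cmod (z + RtoC y)%C) by (apply Rinv_0_lt_compat; lra).
    pose proof (Cmod_ge_0 (zpow (z + RtoC y) t)).
    replace (2 / Cmod z ^ 2) with (2 * (1 * (/ Cmod z * / Cmod z))) by (field; lra).
    apply Rmult_le_compat; [lra | | lra |].
    + apply Rmult_le_pos; [assumption |]; apply Rmult_le_pos; lra.
    + apply Rmult_le_compat; [assumption | apply Rmult_le_pos; lra | assumption |].
      apply Rmult_le_compat; lra. }
(* The derivative of [F] is [G 0 - G x], already bounded by [HG], and [F 1 - F 0] is the error to be
   estimated. *)
set (F := fun x => (RtoC x * G 0 + / RtoC t * zpow (z + RtoC x) t)%C).
replace (zpow z t * / z - (zpow z t / RtoC t - zpow (z + RtoC 1) t / RtoC t))%C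
  with (F 1 - F 0)%C.
2: { unfold F, G; rewrite Cplus_0_r; unfold Cdiv; ring. }
replace (8 / Cmod z ^ 2) with (2 * (4 / Cmod z ^ 2) * 1) by (field; lra).
apply (is_Cderive_bound F (fun x => - (G x - G 0))%C); [lra | |].
- intros x Hx.
  assert (Hx' : 0 < Re (z + RtoC x)%C) by (apply Re_shift_pos; lra).
  replace (- (G x - G 0))%C with
    ((RtoC 1 * G 0 + RtoC x * RtoC 0)
     + / RtoC t * (RtoC (- t) * / (z + RtoC x) * zpow (z + RtoC x) t))%C.
  + apply is_Cderive_plus.
    * apply (is_Cderive_mult (fun u => RtoC u) (fun _ => G 0)).
      -- apply is_Cderive_RtoC; exact (is_derive_id (K := R_AbsRing) x).
      -- apply is_Cderive_const.
    * apply is_Cderive_scal, is_Cderive_zpow_shift; lra.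
  + unfold G; rewrite RtoC_opp; field.
    repeat split; [apply Re_pos_neq_0, Hz | apply Re_pos_neq_0, Hx' | exact Ht0].
- intros x Hx; rewrite Cmod_opp; apply HG; exact Hx.
Qed.

(** The inequality [8/m^2 <= 16 (1/m - 1/(m+1))] makes the cell errors telescope. *)
Lemma zpow_tail_bound (a : C) (t : R) (M K : nat) :
  0 < Re a -> 0 < t <= 1 -> (0 < M)%nat ->
  Cmod (csum (fun n => zpow (a + RtoC (INR n)) t * / (a + RtoC (INR n)))%C (M + K)
        - csum (fun n => zpow (a + RtoC (INR n)) t * / (a + RtoC (INR n)))%C M
        - (zpow (a + RtoC (INR M)) t / RtoC t
           - zpow (a + RtoC (INR (M + K))) t / RtoC t))%C
  <= 16 * (/ INR M - / INR (M + K)).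
Proof.
intros Ha Ht HM.
set (P := fun n => (zpow (a + RtoC (INR n)) t * / (a + RtoC (INR n)))%C).
induction K as [|K IH].
- rewrite Nat.add_0_r.
  replace (_ - _)%C with (RtoC 0) by ring.
  rewrite Cmod_0; lra.
- rewrite Nat.add_succ_r.
  set (m := (M + K)%nat) in *.
  assert (Hm : 1 <= INR m) by (apply (le_INR 1); lia).
  change (csum P (S m)) with (csum P m + P m)%C.
  destruct (Cmod_shift_ge a (INR m) Ha) as [_ H2]; [lra |].
  pose proof (zpow_cell_bound (a + RtoC (INR m)) t) as H.
  rewrite <- Cplus_assoc, <- RtoC_INR_S in H.
  specialize (H (Re_shift_pos a (INR m) Ha ltac:(lra)) ltac:(lra) Ht).
  set (b := (a + RtoC (INR m))%C) in *.
  replace (csum P m + P m - csum P M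
    - (zpow (a + RtoC (INR M)) t / RtoC t - zpow (a + RtoC (INR (S m))) t / RtoC t))%C
    with ((csum P m - csum P M - (zpow (a + RtoC (INR M)) t / RtoC t - zpow b t / RtoC t))
       + (P m - (zpow b t / RtoC t - zpow (a + RtoC (INR (S m))) t / RtoC t)))%C by ring.
  apply Rle_trans with (1 := Cmod_triangle _ _).
  apply Rle_trans with (1 := Rplus_le_compat _ _ _ _ IH H).
  rewrite S_INR.
  assert (8 / Cmod b ^ 2 <= 16 * (/ INR m - / (INR m + 1))).
  { replace (16 * (/ INR m - / (INR m + 1))) with (8 * / (INR m * (INR m + 1) / 2))
      by (field; lra).
    apply Rmult_le_compat_l; [lra |].
    apply Rinv_le_contravar; [nra |].
    assert (INR m ^ 2 <= Cmod b ^ 2) by (apply pow_incr; lra).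
    nra. }
  lra.
Qed.

Lemma csum_ext (f g : nat -> C) (n : nat) :
  (forall k, f k = g k) -> csum f n = csum g n.
Proof. intros E; induction n as [|n IH]; simpl; [| rewrite IH, E]; reflexivity. Qed.

Lemma zpow_shift_vanish (a : C) (t eps : R) :
  0 < Re a -> 0 < t -> 0 < eps ->
  exists N, forall n, (N <= n)%nat -> Cmod (zpow (a + RtoC (INR n)) t) <= eps.
Proof.
intros Ha Ht He.
(* The threshold is [eps^(-1/t)]. *)
destruct (INR_unbounded (exp (- ln eps / t))) as [N HN].
exists N; intros n Hn; rewrite Cmod_zpow.
assert (Hn' : INR N <= INR n) by (apply le_INR; exact Hn).
destruct (Cmod_shift_ge a (INR n) Ha (pos_INR n)) as [_ H].
assert (Hl : - ln eps / t <= ln (Cmod (a + RtoC (INR n))%C)).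
{ rewrite <- (ln_exp (- ln eps / t)); apply ln_le; [apply exp_pos | lra]. }
rewrite <- (exp_ln eps He); apply exp_le_compat.
apply (Rmult_le_compat_l t) in Hl; [| lra].
replace (t * (- ln eps / t)) with (- ln eps) in Hl by (field; lra).
lra.
Qed.

Lemma hurwitz_tail_bound (a : C) (Z : C -> C) (t : R) (M : nat) :
  0 < Re a -> is_hurwitz_zeta a Z -> 0 < t <= 1 -> (0 < M)%nat ->
  Cmod (Z (RtoC (1 + t))
        - csum (fun n => zpow (a + RtoC (INR n)) t * / (a + RtoC (INR n)))%C M
        - zpow (a + RtoC (INR M)) t / RtoC t)%C <= 16 / INR M.
Proof.
intros Ha [HZ _] Ht HM.
specialize (HZ (RtoC (1 + t)) ltac:(simpl; lra)).
set (P := fun n => (zpow (a + RtoC (INR n)) t * / (a + RtoC (INR n)))%C).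
apply Rle_plus_epsilon; intros eps He.
destruct (zpow_shift_vanish a t (eps / 2 * t) Ha) as [N1 HN1]; [lra | nra |].
apply filterlim_locally_ball_norm with (eps := mkposreal (eps / 2) ltac:(lra)) in HZ.
destruct HZ as [N2 HN2].
(* [sum_n] includes its last index: the sum up to [M + N1 + N2] has [M + K] terms. *)
set (K := S (N1 + N2)).
specialize (HN1 (M + K)%nat ltac:(lia)).
specialize (HN2 (M + N1 + N2)%nat ltac:(lia)).
pose proof (zpow_tail_bound a t M K Ha Ht HM) as H; fold P in H.
assert (E : sum_n (fun n => Cpower (RtoC (INR n) + a) (- RtoC (1 + t)))%C (M + N1 + N2)
            = csum P (M + K)).
{ unfold K; replace (M + S (N1 + N2))%nat with (S (M + N1 + N2)) by lia.
  rewrite <- sum_n_csum; apply sum_n_ext; intros n; unfold P.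
  rewrite (Cplus_comm (RtoC (INR n))); apply Cpower_zpow, Re_shift_pos;
    [exact Ha | apply pos_INR]. }
unfold ball_norm in HN2; simpl in HN2.
change (Cmod (sum_n (G := C_AbelianMonoid)
                (fun n => Cpower (RtoC (INR n) + a) (- RtoC (1 + t)))%C (M + N1 + N2)
              - Z (RtoC (1 + t)))%C < eps / 2) in HN2.
rewrite E in HN2.
set (S1 := csum P (M + K)) in *; set (S0 := csum P M) in *.
set (z := Z (RtoC (1 + t))) in *.
set (q := zpow (a + RtoC (INR (M + K))) t) in *.
replace (z - S0 - zpow (a + RtoC (INR M)) t / RtoC t)%C
  with ((S1 - S0 - (zpow (a + RtoC (INR M)) t / RtoC t - q / RtoC t))
        + (- (S1 - z) + - (q / RtoC t)))%C by ring.
apply Rle_trans with (1 := Cmod_triangle _ _).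
assert (Hq : Cmod (q / RtoC t)%C <= eps / 2).
{ rewrite Cmod_div, Cmod_R, Rabs_pos_eq by (lra || (intros E'; apply RtoC_inj in E'; lra)).
  apply Rle_div_l; lra. }
pose proof (Cmod_triangle (- (S1 - z))%C (- (q / RtoC t))%C) as H'.
rewrite !Cmod_opp in H'.
assert (HK : 0 < / INR (M + K)) by (apply Rinv_0_lt_compat, lt_0_INR; lia).
unfold Rdiv; lra.
Qed.

Lemma at_right_lt (d : R) : 0 < d -> at_right 0 (fun t => 0 < t < d).
Proof.
intros Hd; exists (mkposreal d Hd); intros t Ht Ht0.
assert (H : Rabs (t - 0) < d) by exact Ht.
apply Rabs_lt_between in H; lra.
Qed.

(** At [t = 0] the derivative of [z^(-t)] in the exponent is [- Cln z]. *)
Lemma zpow_diff_at_right (z : C) (eps : R) :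
  0 < eps -> at_right 0 (fun t => Cmod ((zpow z t - RtoC 1) / RtoC t + Cln z)%C <= eps).
Proof.
intros He.
assert (H : is_Cderive (fun t => zpow z t) 0 (- Cln z)%C).
{ replace (- Cln z)%C with ((RtoC (-1) * Cln z + RtoC (- 0) * RtoC 0) * zpow z 0)%C.
  - apply (is_Cderive_Cexp (fun t => RtoC (- t) * Cln z)%C).
    apply (is_Cderive_mult (fun t => RtoC (- t)) (fun _ => Cln z));
      [| apply is_Cderive_const].
    apply is_Cderive_RtoC; auto_derive; [exact I | ring].
  - unfold zpow; rewrite Ropp_0; replace (RtoC 0 * Cln z)%C with (RtoC 0) by ring.
    rewrite Cexp_0; replace (-1) with (- (1)) by ring; rewrite RtoC_opp; ring. }
pose proof (is_Cderive_at_right _ _ eps H He) as H'.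
revert H'; apply filter_imp; intros t Ht.
replace (zpow z 0) with (RtoC 1) in Ht.
- replace ((zpow z t - RtoC 1) / RtoC t + Cln z)%C
    with ((zpow z t - RtoC 1) / RtoC t - - Cln z)%C by ring; exact Ht.
- unfold zpow; rewrite Ropp_0; replace (RtoC 0 * Cln z)%C with (RtoC 0) by ring.
  symmetry; exact Cexp_0.
Qed.

Lemma zpow_at_right (z : C) (eps : R) :
  0 < eps -> at_right 0 (fun t => Cmod (zpow z t - RtoC 1)%C <= eps).
Proof.
intros He.
set (B := Cmod (Cln z) + 1).
assert (HB : 0 < B) by (unfold B; pose proof (Cmod_ge_0 (Cln z)); lra).
pose proof (filter_and (F := at_right 0) _ _ (zpow_diff_at_right z 1 Rlt_0_1)
  (at_right_lt (eps / B) (Rdiv_lt_0_compat _ _ He HB))) as H.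
revert H; apply filter_imp; intros t [H1 Ht].
assert (Ht0 : RtoC t <> RtoC 0) by (intros E; apply RtoC_inj in E; lra).
replace (zpow z t - RtoC 1)%C
  with (RtoC t * (((zpow z t - RtoC 1) / RtoC t + Cln z) + - Cln z))%C
  by (field; exact Ht0).
rewrite Cmod_mult, Cmod_R, Rabs_pos_eq by lra.
pose proof (Cmod_triangle ((zpow z t - RtoC 1) / RtoC t + Cln z)%C (- Cln z)%C) as H2.
rewrite Cmod_opp in H2.
apply Rle_trans with (t * B).
- apply Rmult_le_compat_l; unfold B; lra.
- destruct Ht as [_ Ht]; apply Rlt_div_r in Ht; lra.
Qed.

Lemma csum_zpow_at_right (a : C) (M : nat) (eps : R) :
  0 < Re a -> 0 < eps -> at_right 0 (fun t =>
    Cmod (csum (fun n => zpow (a + RtoC (INR n)) t * / (a + RtoC (INR n)))%C M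
          - csum (fun n => / (a + RtoC (INR n)))%C M)%C <= eps).
Proof.
intros Ha; revert eps; induction M as [|M IH]; intros eps He.
- apply filter_forall; intros t; simpl.
  replace (RtoC 0 - RtoC 0)%C with (RtoC 0) by ring; rewrite Cmod_0; lra.
- set (b := (a + RtoC (INR M))%C).
  assert (Hb : 0 < Re b) by (apply Re_shift_pos; [exact Ha | apply pos_INR]).
  pose proof (Cmod_pos b Hb) as Hb'.
  pose proof (filter_and (F := at_right 0) _ _ (IH (eps / 2) ltac:(lra))
    (zpow_at_right b (eps / 2 * Cmod b) ltac:(apply Rmult_lt_0_compat; lra))) as H.
  revert H; apply filter_imp; intros t [H1 H2]; simpl; fold b.
  set (S2 := csum (fun n => / (a + RtoC (INR n)))%C M) in *; clearbody S2.
  set (S1 := csum _ M) in *.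
  replace (S1 + zpow b t * / b - (S2 + / b))%C
    with ((S1 - S2) + (zpow b t - RtoC 1) * / b)%C by ring.
  apply Rle_trans with (1 := Cmod_triangle _ _).
  rewrite Cmod_mult, Cmod_inv by (apply Re_pos_neq_0, Hb).
  assert (Cmod (zpow b t - RtoC 1)%C * / Cmod b <= eps / 2)
    by (apply Rle_div_l; assumption).
  lra.
Qed.

Lemma pow_n_RtoC (t : R) (k : nat) : pow_n (K := C_Ring) (RtoC t) k = RtoC (t ^ k).
Proof.
induction k as [|k IH]; [reflexivity |].
simpl; rewrite IH, RtoC_mult; reflexivity.
Qed.

(* Abel-type continuity at the centre, from convergence at a single point. *)
Lemma pseries_at_right (b : nat -> C) (f : R -> C) (eps : R) :
  at_right 0 (fun t => is_pseries (K := C_AbsRing) (V := C_NormedModule) b (RtoC t) (f t)) ->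
  0 < eps -> at_right 0 (fun t => Cmod (f t - b O)%C <= eps).
Proof.
intros H He.
destruct (filter_ex _ (filter_and (F := at_right 0) _ _ H (at_right_lt 1 Rlt_0_1)))
  as [rho [Hrho Hr]].
destruct (filterlim_bounded (K := C_AbsRing) (V := C_NormedModule)
  (sum_n (fun k => scal (pow_n (K := C_Ring) (RtoC rho) k) (b k)))) as [B HB];
  [exists (f rho); exact Hrho |].
assert (HB0 : 0 <= B) by (apply Rle_trans with (2 := HB O), norm_ge_0).
(* A term is the difference of two partial sums, each bounded by [B]. *)
assert (Hterm : forall k, Cmod (b (S k)) * rho ^ S k <= 2 * B).
{ intros k; pose proof (HB (S k)) as H1; pose proof (HB k) as H0.
  rewrite sum_Sn in H1.
  set (s := sum_n _ k) in *.
  assert (E : Cmod (RtoC (rho ^ S k) * b (S k))%C <= 2 * B).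
  { rewrite pow_n_RtoC in H1.
    change (Cmod (s + RtoC (rho ^ S k) * b (S k))%C <= B) in H1.
    change (Cmod s <= B) in H0.
    replace (RtoC (rho ^ S k) * b (S k))%C
      with ((s + RtoC (rho ^ S k) * b (S k)) + - s)%C by ring.
    apply Rle_trans with (1 := Cmod_triangle _ _); rewrite Cmod_opp; lra. }
  rewrite Cmod_mult, Cmod_R, Rabs_pos_eq in E; [lra | apply pow_le; lra]. }
(* For [t <= rho / 2] the terms after the first are dominated by a geometric series of ratio 1/2.
   The factor [1 - (/ 2) ^ n] is its normalised partial sum, kept so that the induction closes. *)
assert (Hpart : forall t, 0 < t <= rho / 2 -> forall n,
   Cmod (sum_n (G := C_AbelianMonoid) (fun k => RtoC (t ^ k) * b k)%C n - b O)%C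
   <= 4 * B * (t / rho) * (1 - (/ 2) ^ n)).
{ intros t Ht n; induction n as [|n IH].
  - rewrite sum_O; simpl; replace (RtoC 1 * b O - b O)%C with (RtoC 0) by ring.
    rewrite Cmod_0; lra.
  - rewrite sum_Sn.
    change (plus ?x ?y) with (x + y)%C.
    set (s := sum_n _ n) in *.
    replace (s + RtoC (t ^ S n) * b (S n) - b O)%C
      with ((s - b O) + RtoC (t ^ S n) * b (S n))%C by ring.
    apply Rle_trans with (1 := Cmod_triangle _ _).
    apply Rle_trans with (1 := Rplus_le_compat_r _ _ _ IH).
    rewrite Cmod_mult, Cmod_R, Rabs_pos_eq by (apply pow_le; lra).
    assert (Hq : 0 <= t / rho <= / 2).
    { split; [apply Rdiv_le_0_compat; lra | apply Rle_div_l; lra]. }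
    assert (Hqn : (t / rho) ^ n <= (/ 2) ^ n) by (apply pow_incr; exact Hq).
    assert (Hstep : t ^ S n * Cmod (b (S n)) <= t / rho * (/ 2) ^ n * (2 * B)).
    { replace (t ^ S n * Cmod (b (S n)))
        with ((t / rho) ^ S n * (Cmod (b (S n)) * rho ^ S n)).
      - apply Rmult_le_compat; [apply pow_le; lra | | | apply Hterm].
        + apply Rmult_le_pos; [apply Cmod_ge_0 | apply pow_le; lra].
        + simpl; apply Rmult_le_compat_l; lra.
      - unfold Rdiv; rewrite Rpow_mult_distr, pow_inv; field.
        apply pow_nonzero; lra. }
    simpl ((/ 2) ^ S n); lra. }
(* The denominator is [4 * B + 1] because [B] may be 0. *)
pose proof (filter_and (F := at_right 0) _ _ H
  (filter_and (F := at_right 0) _ _ (at_right_lt (rho / 2) ltac:(lra))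
  (at_right_lt (eps * rho / (4 * B + 1)) ltac:(apply Rdiv_lt_0_compat; nra)))) as H'.
revert H'; apply filter_imp; intros t [Hs [Ht1 Ht2]].
apply Rle_trans with (4 * B * (t / rho)).
- apply Rle_plus_epsilon; intros d Hd.
  apply filterlim_locally_ball_norm with (eps := mkposreal d Hd) in Hs.
  destruct Hs as [N HN]; specialize (HN N (Nat.le_refl N)).
  rewrite (sum_n_ext _ (fun k => RtoC (t ^ k) * b k)%C) in HN
    by (intros k; rewrite <- pow_n_RtoC; reflexivity).
  change (Cmod (sum_n (G := C_AbelianMonoid) (fun k => RtoC (t ^ k) * b k)%C N
                - f t)%C < d) in HN.
  pose proof (Hpart t ltac:(lra) N) as H1.
  set (s := sum_n _ N) in *.
  replace (f t - b O)%C with (- (s - f t) + (s - b O))%C by ring.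
  apply Rle_trans with (1 := Cmod_triangle _ _); rewrite Cmod_opp.
  assert (0 <= 4 * B * (t / rho) * (/ 2) ^ N).
  { apply Rmult_le_pos; [| apply pow_le; lra].
    apply Rmult_le_pos; [lra | apply Rdiv_le_0_compat; lra]. }
  lra.
- destruct Ht2 as [_ Ht2]; apply Rlt_div_r in Ht2; [| lra].
  replace (4 * B * (t / rho)) with (4 * B * t / rho) by (field; lra).
  apply Rle_div_l; [lra | nra].
Qed.

(** The pole [1/t] of zeta(1+t, a) cancels the one in [b^(-t)/t], whose remaining part tends to
    [- Cln b]. Since [hurwitz_tail_bound] is uniform in [t], a single small [t] at which the three
    limits are attained within [eps / 3] suffices. *)
Lemma stieltjes_0_limit (a : C) (g : nat -> C) (M : nat) :
  0 < Re a -> is_stieltjes a g -> (0 < M)%nat ->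
  Cmod (g O - csum (fun n => / (a + RtoC (INR n)))%C M + Cln (a + RtoC (INR M)))%C
  <= 16 / INR M.
Proof.
intros Ha [Z [HZ Hg]] HM.
set (b := (a + RtoC (INR M))%C).
apply Rle_plus_epsilon; intros eps He.
assert (H0 : at_right 0 (fun t =>
  Cmod (Z (RtoC (1 + t)) - RtoC 1 / RtoC t - g O)%C <= eps / 3)).
{ replace (g O) with (RtoC ((-1) ^ 0 / INR (fact 0)) * g O)%C
    by (simpl; replace (1 / 1) with 1 by field; ring).
  apply (pseries_at_right (fun n => (RtoC ((-1) ^ n / INR (fact n)) * g n)%C)); [| lra].
  destruct Hg as [d Hd]; exists d; intros t Ht Ht0.
  specialize (Hd (RtoC (1 + t))).
  replace (RtoC (1 + t) - RtoC 1)%C with (RtoC t) in Hd by (rewrite RtoC_plus; ring).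
  apply Hd.
  - split; simpl.
    + assert (Ht' : Rabs (t - 0) < d) by exact Ht.
      change (Rabs (1 + t - 1) < d).
      replace (1 + t - 1) with (t - 0) by ring; exact Ht'.
    + apply ball_center.
  - intros E; apply RtoC_inj in E; lra. }
pose proof (filter_and (F := at_right 0) _ _
  (filter_and (F := at_right 0) _ _ H0 (at_right_lt 1 Rlt_0_1))
  (filter_and (F := at_right 0) _ _ (csum_zpow_at_right a M (eps / 3) Ha ltac:(lra))
     (zpow_diff_at_right b (eps / 3) ltac:(lra)))) as H.
destruct (filter_ex _ H) as [t [[H1 Ht] [H2 H3]]].
pose proof (hurwitz_tail_bound a Z t M Ha HZ ltac:(lra) HM) as H4.
fold b in H4.
set (S2 := csum (fun n => / (a + RtoC (INR n)))%C M) in *; clearbody S2.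
set (S1 := csum _ M) in *.
assert (Ht0 : RtoC t <> RtoC 0) by (intros E; apply RtoC_inj in E; lra).
replace (g O - S2 + Cln b)%C
  with ((Z (RtoC (1 + t)) - S1 - zpow b t / RtoC t)
    + (- (Z (RtoC (1 + t)) - RtoC 1 / RtoC t - g O)
       + ((S1 - S2) + ((zpow b t - RtoC 1) / RtoC t + Cln b))))%C
  by (field; exact Ht0).
apply Rle_trans with (1 := Cmod_triangle _ _).
apply Rplus_le_compat; [exact H4 |].
apply Rle_trans with (1 := Cmod_triangle _ _); rewrite Cmod_opp.
pose proof (Cmod_triangle (S1 - S2)%C ((zpow b t - RtoC 1) / RtoC t + Cln b)%C).
lra.
Qed.

(** * The asymptotic expansion *)

Lemma csum_S (f : nat -> C) (n : nat) : csum f (S n) = (csum f n + f n)%C.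
Proof. reflexivity. Qed.

(** At 0 only index 1 and the even indices contribute. [bern 1 0 = -1/2] gives [+ 1/(2a)], which the
    [- / a] of [em_approx] turns into [- 1/(2a)]. *)
Lemma em_0_odd (a : C) (N : nat) :
  em a (2 * N + 3) 0 =
  (Cln a + RtoC (/ 2) * / a
   - csum (fun k => RtoC (INR (fact (2 * k + 1)) * bern (2 * k + 2) 0)
                    * (/ a) ^ (2 * k + 2)) (S N))%C.
Proof.
assert (Estep : forall L, em a (S L) 0
   = (em a L 0 - RtoC (INR (fact L) * bern (S L) 0) * (/ a) ^ S L)%C).
{ intros L.
  change (em a (S L) 0)
    with (em a L 0 - RtoC (INR (fact L) * bern (S L) 0) * (/ (a + RtoC 0)) ^ S L)%C.
  rewrite Cplus_0_r; reflexivity. }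
assert (Eodd : forall k, em a (2 * k + 3) 0
   = (em a (2 * k + 1) 0 - RtoC (INR (fact (2 * k + 1)) * bern (2 * k + 2) 0)
                           * (/ a) ^ (2 * k + 2))%C).
{ intros k.
  replace (2 * k + 3)%nat with (S (2 * k + 2)) by lia; rewrite Estep.
  replace (S (2 * k + 2)) with (2 * k + 3)%nat by lia; rewrite bern_odd_at_0.
  replace (2 * k + 2)%nat with (S (2 * k + 1)) by lia; rewrite Estep.
  rewrite Rmult_0_r; ring. }
induction N as [|N IH].
- rewrite Eodd.
  change (2 * 0 + 1)%nat with 1%nat; rewrite Estep, bern_1.
  change (em a 0 0) with (Cln (a + RtoC 0)%C); rewrite Cplus_0_r, Cpow_1_r.
  replace (INR (fact 0) * (0 - / 2)) with (- / 2) by (simpl; ring).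
  rewrite csum_S; change (csum _ 0) with (RtoC 0).
  change (2 * 0 + 1)%nat with 1%nat; change (2 * 0 + 2)%nat with 2%nat.
  rewrite RtoC_opp; ring.
- rewrite Eodd.
  replace (2 * S N + 1)%nat with (2 * N + 3)%nat at 1 by lia.
  rewrite IH, (csum_S _ (S N)); ring.
Qed.

(** The Bernoulli value is [2 (-1)^k zeta(2k+2) / (2 PI)^(2k+2)] and the Stirling sum is
    [- zeta(2k+2)]. The constants agree because [2 / (2 PI)^(2k+2) = 1 / (PI (2 PI)^(2k+1))]. *)
Lemma stirling_coefficient (k : nat) (a : C) :
  a <> RtoC 0 ->
  (RtoC 1 / (RtoC PI * a)
   * (RtoC (INR (fact (2 * k + 1)) * (-1) ^ k) / (RtoC (2 * PI) * a) ^ (2 * k + 1)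
      * RtoC (Series (fun m => stirling_term k (S m)))))%C
  = (- (RtoC (INR (fact (2 * k + 1)) * bern (2 * k + 2) 0) * (/ a) ^ (2 * k + 2)))%C.
Proof.
intros Ha; destruct (ex_series_zeta k) as [z Hz].
rewrite (is_series_unique _ _ (is_series_stirling_term k z Hz)).
rewrite (bern_even_at_0 k z Hz).
pose proof PI_neq0 as Hpi.
assert (HC : RtoC PI <> RtoC 0) by (intros E; apply RtoC_inj in E; exact (Hpi E)).
assert (H2 : RtoC (2 * PI) <> RtoC 0) by (intros E; apply RtoC_inj in E; lra).
replace (2 * k + 2)%nat with (S (2 * k + 1)) by lia.
set (n := (2 * k + 1)%nat).
replace (INR (fact n) * (2 * ((-1) ^ k / (2 * PI) ^ S n * z)))
  with (INR (fact n) * (-1) ^ k * (/ PI * / (2 * PI) ^ n * z))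
  by (simpl; field; split; [apply pow_nonzero |]; lra).
rewrite Cpow_mult_l, Cpow_inv by exact Ha.
rewrite !(RtoC_mult (INR (fact n) * (-1) ^ k)), !(RtoC_mult (_ * _) z), (RtoC_mult (/ PI)).
rewrite !RtoC_inv, RtoC_pow, RtoC_opp, Cpow_S
  by (exact Hpi || (apply pow_nonzero; lra)).
field; repeat split; try assumption; apply Cpow_nz; assumption.
Qed.

Lemma stirling_partial_sum (a : C) (N : nat) :
  a <> RtoC 0 ->
  (RtoC 1 / (RtoC 2 * a) - Cln a
   - RtoC 1 / (RtoC PI * a)
     * sum_n (G := C_AbelianMonoid)
         (fun k : nat =>
            RtoC (INR (fact (2 * k + 1)) * (-1) ^ k)
            / (RtoC (2 * PI) * a) ^ (2 * k + 1)
            * RtoC (Series (fun m : nat => stirling_term k (S m)))) N)%C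
  = (- em_approx (2 * N + 2) a)%C.
Proof.
intros Ha; rewrite sum_n_csum; unfold em_approx.
replace (S (2 * N + 2)) with (2 * N + 3)%nat by lia; rewrite em_0_odd.
generalize (S N) as m; intros m.
assert (E : forall f c, (c * csum f m)%C = csum (fun k => c * f k)%C m).
{ intros f c; induction m as [|m IH]; simpl; [| rewrite <- IH]; ring. }
assert (Eopp : forall f, csum (fun k => - f k)%C m = (- csum f m)%C).
{ intros f; clear E; induction m as [|m IH]; simpl; [| rewrite IH]; ring. }
rewrite E, (csum_ext _ _ m (fun k => stirling_coefficient k a Ha)), Eopp.
rewrite RtoC_inv by lra; field; exact Ha.
Qed.

Theorem proposition1 (gamma : nat -> C -> C)
  (Hgamma : forall a : C, 0 < Re a -> is_stieltjes a (fun n : nat => gamma n a)) :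
  (forall k : nat, ex_series (fun m : nat => stirling_term k (S m))) /\
  (forall N : nat,
     is_domin (Ku := C_AbsRing) (Kv := C_AbsRing)
       (U := C_NormedModule) (V := C_NormedModule)
       (within (fun a : C => 0 < Re a) Cinfty)
       (fun a : C => (RtoC 1 / a ^ (2 * N + 2))%C)
       (fun a : C =>
          (gamma 0%nat a
           - (RtoC 1 / (RtoC 2 * a) - Cln a
              - RtoC 1 / (RtoC PI * a)
                * sum_n (G := C_AbelianMonoid)
                    (fun k : nat =>
                       RtoC (INR (fact (2 * k + 1)) * (-1) ^ k)
                       / (RtoC (2 * PI) * a) ^ (2 * k + 1)
                       * RtoC (Series (fun m : nat => stirling_term k (S m))))
                    N))%C)).
Proof.
split.
- intros k; destruct (ex_series_zeta k) as [z Hz].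
  exists (- z); apply is_series_stirling_term; exact Hz.
- intros N eps; destruct (em_approx_error (2 * N + 2)) as [K [HK Herr]].
  (* The error bound is [K |a|^-(2N+2) / (|a| - 1)], and beyond this radius [|a| - 1] exceeds
     [K / eps]. *)
  exists (1 + K / eps); intros a Ha Hre.
  pose proof (cond_pos eps) as He.
  assert (HKe : 0 <= K / eps) by (apply Rdiv_le_0_compat; lra).
  pose proof (Re_pos_neq_0 a Hre) as Ha0.
  rewrite stirling_partial_sum by exact Ha0.
  change (Cmod (gamma 0%nat a - - em_approx (2 * N + 2) a)%C
          <= eps * Cmod (RtoC 1 / a ^ (2 * N + 2))%C).
  replace (gamma 0%nat a - - em_approx (2 * N + 2) a)%C
    with (gamma 0%nat a + em_approx (2 * N + 2) a)%C by ring.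
  apply Rle_trans with (1 := Herr a (gamma 0%nat a) 16 Hre ltac:(lra)
    (fun M HM => stieltjes_0_limit a _ M Hre (Hgamma a Hre) HM)).
  rewrite Cmod_div, Cmod_1, Cmod_pow by (apply Cpow_nz; exact Ha0).
  rewrite pow_inv; unfold Rdiv; rewrite Rmult_1_l.
  assert (Hp : 0 < / Cmod a ^ (2 * N + 2)) by (apply Rinv_0_lt_compat, pow_lt; lra).
  apply Rle_div_l; [lra |].
  assert (K <= eps * (Cmod a - 1)).
  { apply Rlt_le; rewrite Rmult_comm; apply Rlt_div_l; lra. }
  nra.
Qed.
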